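(* For every $n \geq 2$, the volume product $|K|\,|\mathrm{J}^{\circ}K|$ is unbounded (as $K$ ranges over convex bodies in $\mathbb{R}^n$ with non-empty interior) for the weakly monotone Minkowski endomorphism $\mathrm{J}: \mathcal{K}^n \rightarrow \mathcal{K}^n$, $\mathrm{J}K = K - s(K)$.
   Context: $\mathcal{K}^n$ is the space of convex bodies (non-empty compact convex sets) in $\mathbb{R}^n$ with the Hausdorff metric; $|\cdot|$ is volume; $B^n$ is the Euclidean unit ball; $h(K,u)=\max\{u\cdot x:x\in K\}$. The Steiner point of $K$ is $s(K)=\frac{1}{|B^n|}\int_{\mathbb{S}^{n-1}}h(K,u)\,u\,du$ (integration with respect to spherical Lebesgue measure); it lies in the interior of $K$ if $K$ has non-empty interior. $\mathrm{J}^\circ K:=(\mathrm{J}K)^\circ=\{x: x\cdot y\le1\text{ for all }y\in \mathrm{J}K\}$ is the polar body of $\mathrm{J}K$ with respect to the origin. A Minkowski endomorphism is a continuous, Minkowski additive, translation invariant map $\mathcal{K}^n\to\mathcal{K}^n$ commuting with $\mathrm{SO}(n)$. A map $\Phi:\mathcal{K}^n\to\mathcal{K}^n$ is weakly monotone if $\Phi K\subseteq\Phi L$ whenever $K\subseteq L$ and $s(K)=s(L)=o$. *)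

(* Defs.v *)
(* Vectors of R^n are row vectors 'rV[R]_n
   over an arbitrary R : realType. *)
From HB Require Import structures.
From mathcomp Require Import all_boot all_order all_algebra.
From mathcomp Require Import all_classical all_reals all_analysis measurable_realfun.

Set Implicit Arguments.
Unset Strict Implicit.
Unset Printing Implicit Defensive.

Import Order.TTheory GRing.Theory Num.Theory.
Import numFieldNormedType.Exports.

Local Open Scope classical_set_scope.
Local Open Scope ring_scope.

(* The product sigma-algebra on R^n (equivalently, the Borel one). *)
Definition rV_display : measure_display. Proof. exact. Qed.

Section rV_measurable.
Context (R : realType) (n : nat).

Definition rV_coord (i : 'I_n) (x : 'rV[R]_n) : R := x 0 i.

Definition rV_measurable : set (set 'rV[R]_n) := g_sigma_preimage rV_coord.

Let rV_set0 : rV_measurable set0.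
Proof. exact: sigma_algebra0. Qed.

Let rV_setC A : rV_measurable A -> rV_measurable (~` A).
Proof. exact: sigma_algebraC. Qed.

Let rV_bigcup (F : _^nat) : (forall i, rV_measurable (F i)) ->
  rV_measurable (\bigcup_i (F i)).
Proof. exact: sigma_algebra_bigcup. Qed.

HB.instance Definition _ := @isMeasurable.Build rV_display
  'rV[R]_n rV_measurable rV_set0 rV_setC rV_bigcup.

Lemma measurable_rV_coord (i : 'I_n) : measurable_fun setT (rV_coord i).
Proof.
move=> _ Y mY; rewrite setTI; apply: sub_sigma_algebra => /=.
rewrite -bigcup_seq/=; exists i => /=; first by rewrite mem_index_enum.
by exists Y => //; rewrite setTI.
Qed.

Lemma measurable_fun_rV d (T : measurableType d) (f : T -> 'rV[R]_n) :
  (forall i, measurable_fun setT (fun t => f t 0 i)) -> measurable_fun setT f.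
Proof.
move=> mf.
suff H : g_sigma_preimage (fun i => rV_coord i \o f) `<=` measurable.
  move=> _ A mA; apply: H; rewrite g_sigma_preimage_comp.
  by exists A.
apply: smallest_sub; first exact: sigma_algebra_measurable.
rewrite -bigcup_seq; apply: bigcup_sub => i _ A [B mB <-].
exact: (mf i).
Qed.

End rV_measurable.

Section rV_cons.
Context (R : realType) (n : nat).

(* The identification R x R^n = R^(n+1). *)
Definition rV_cons (p : R * 'rV[R]_n) : 'rV[R]_n.+1 :=
  row_mx (const_mx p.1 : 'rV_1) p.2.

Lemma measurable_rV_cons : measurable_fun setT rV_cons.
Proof.
apply: measurable_fun_rV => i; rewrite /rV_cons.
have [j ->|j ->] := fintype.split_ordP (i : 'I_(1 + n)).
  rewrite (_ : (fun _ => _) = fst); first exact: measurable_fst.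
  by apply/funext => t; rewrite [LHS](@row_mxEl _ 1 1 n) mxE.
rewrite (_ : (fun _ => _) = @rV_coord R n j \o snd).
  by apply: measurableT_comp; [exact: measurable_rV_coord|exact: measurable_snd].
by apply/funext => t; rewrite [LHS](@row_mxEr _ 1 1 n).
Qed.

Context (m : {sigma_finite_measure set 'rV[R]_n -> \bar R}).

Definition lebesgue_cons : set 'rV[R]_n.+1 -> \bar R :=
  pushforward (@lebesgue_measure R \x m)%E rV_cons.

Lemma measurable_preimage_rV_cons A :
  measurable A -> measurable (rV_cons @^-1` A).
Proof.
by move=> mA; rewrite -[X in measurable X]setTI; exact: measurable_rV_cons.
Qed.

Let lebesgue_cons0 : lebesgue_cons set0 = 0%E.
Proof. by rewrite /lebesgue_cons /pushforward preimage_set0 measure0. Qed.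

Let lebesgue_cons_ge0 A : (0 <= lebesgue_cons A)%E.
Proof. by rewrite /lebesgue_cons /pushforward; exact: integral_ge0. Qed.

Let lebesgue_cons_sigma_additive : semi_sigma_additive lebesgue_cons.
Proof.
move=> F mF tF mUF; rewrite /lebesgue_cons /pushforward preimage_bigcup.
apply: measure_semi_sigma_additive => [k||].
- exact: measurable_preimage_rV_cons.
- apply/trivIsetP => /= i j _ _ ij; rewrite -preimage_setI.
  by move/trivIsetP : tF => /(_ _ _ _ _ ij) ->//; rewrite preimage_set0.
- by rewrite -preimage_bigcup; exact: measurable_preimage_rV_cons.
Qed.

HB.instance Definition _ := isMeasure.Build _ _ _ lebesgue_cons
  lebesgue_cons0 lebesgue_cons_ge0 lebesgue_cons_sigma_additive.

Definition rV_uncons (x : 'rV[R]_n.+1) : R * 'rV[R]_n :=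
  (x ord0 ord0, \row_i x ord0 (lift ord0 i)).

Lemma rV_consK : cancel rV_cons rV_uncons.
Proof.
move=> [a v]; rewrite /rV_uncons /rV_cons; congr pair.
  have -> : (ord0 : 'I_n.+1) = lshift n (ord0 : 'I_1) by exact/val_inj.
  by rewrite [LHS](@row_mxEl _ 1 1 n) mxE.
apply/rowP => i; rewrite mxE.
have -> : lift ord0 i = rshift 1 i by exact/val_inj.
by rewrite [LHS](@row_mxEr _ 1 1 n).
Qed.

Lemma measurable_rV_uncons : measurable_fun setT rV_uncons.
Proof.
apply/measurable_fun_pairP; split; first exact: (measurable_rV_coord ord0).
apply: measurable_fun_rV => i; rewrite /rV_uncons/=.
by under eq_fun do rewrite mxE; exact: (measurable_rV_coord (lift ord0 i)).
Qed.

Let lebesgue_cons_sigma_finite : sigma_finite setT lebesgue_cons.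
Proof.
have /sigma_finiteP[F [FT ndF Foo]] := sigma_finiteT (@lebesgue_measure R).
have /sigma_finiteP[G [GT ndG Goo]] := sigma_finiteT m.
exists (fun i => rV_uncons @^-1` (F i `*` G i)).
  rewrite -preimage_bigcup -(preimage_setT rV_uncons); congr (_ @^-1` _).
  rewrite -setXTT FT GT predeqE => -[x y]; split.
    move=> [/= [i _ Fix] [j _ Gjy]]; exists (maxn i j) => //; split.
    - by move: x Fix; exact/subsetPset/ndF/leq_maxl.
    - by move: y Gjy; exact/subsetPset/ndG/leq_maxr.
  by move=> [i _ []/= ? ?]; split; exists i.
move=> i; have [mF Fi] := Foo i; have [mG Gi] := Goo i; split.
  rewrite -[X in measurable X]setTI; apply: measurable_rV_uncons => //.
  exact: measurableX.
rewrite /lebesgue_cons /pushforward -comp_preimage.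
have -> : rV_uncons \o rV_cons = id by exact/funext/rV_consK.
by rewrite preimage_id product_measure1E// lte_mul_pinfty// ge0_fin_numE.
Qed.

HB.instance Definition _ := @Measure_isSigmaFinite.Build _ _ _ lebesgue_cons
  lebesgue_cons_sigma_finite.

End rV_cons.

(* The n-dimensional Lebesgue measure is the n-fold product of the Lebesgue
   measure of R. *)
Fixpoint lebesgue_rV (R : realType) (n : nat) :
    {sigma_finite_measure set 'rV[R]_n -> \bar R} :=
  match n with
  | 0 => \d_(0 : 'rV[R]_0)
  | k.+1 => lebesgue_cons (lebesgue_rV R k)
  end.

Section euclidean_space.
Context (R : realType) (n : nat).
Implicit Types (x y u v : 'rV[R]_n) (A K L : set 'rV[R]_n).

Definition dot x y : R := \sum_i x 0 i * y 0 i.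

(* The norm `|x| of the library is the maximum norm. *)
Definition enorm x : R := Num.sqrt (dot x x).

Definition eball (r : R) : set 'rV[R]_n := [set x | enorm x <= r].

Definition unit_sphere : set 'rV[R]_n := [set u | enorm u = 1].

(* Spherical Lebesgue measure: n times the volume of the cone
   {t u | 0 < t <= 1, u in A} over a set A of directions. *)
Definition sphere_measure A : \bar R :=
  (n%:R%:E * lebesgue_rV R n
     [set x | (0 < enorm x <= 1)%R /\ A ((enorm x)^-1 *: x)%R])%E.

Lemma measurable_enorm : measurable_fun setT enorm.
Proof.
rewrite (_ : enorm = @Num.sqrt R \o fun x => dot x x)//.
apply: (@measurableT_comp _ _ _ _ _ _ (@Num.sqrt R)).
  apply: continuous_measurable_fun.
  exact: sqrt_continuous.
apply: measurable_sum => i.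
by apply: measurable_funM; exact: (measurable_rV_coord i).
Qed.

Lemma measurable_normalize :
  measurable_fun setT (fun x : 'rV[R]_n => (enorm x)^-1 *: x).
Proof.
apply: measurable_fun_rV => i; under eq_fun do rewrite mxE.
apply: measurable_funM; last exact: (measurable_rV_coord i).
rewrite (_ : (fun _ => _) = (@powR R)^~ (-1) \o enorm).
  exact: measurableT_comp (measurable_powR _) measurable_enorm.
by apply/funext => x /=; rewrite powR_inv1// sqrtr_ge0.
Qed.

Let sphere_preimage A :
  [set x | 0 < enorm x <= 1 /\ A ((enorm x)^-1 *: x)] =
  (enorm @^-1` `]0, 1]%classic) `&` ((fun x => (enorm x)^-1 *: x) @^-1` A).
Proof. by rewrite predeqE => x; split=> -[]; rewrite /= in_itv. Qed.

Lemma measurable_sphere_preimage A : measurable A ->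
  measurable [set x | 0 < enorm x <= 1 /\ A ((enorm x)^-1 *: x)].
Proof.
move=> mA; rewrite sphere_preimage; apply: measurableI;
  rewrite -[X in measurable X]setTI.
  exact: measurable_enorm.
exact: measurable_normalize.
Qed.

Let sphere_measure0 : sphere_measure set0 = 0%E.
Proof.
by rewrite /sphere_measure sphere_preimage preimage_set0 setI0 measure0 mule0.
Qed.

Let sphere_measure_ge0 A : (0 <= sphere_measure A)%E.
Proof. by rewrite mule_ge0// lee_fin. Qed.

Let sphere_measure_sigma_additive : semi_sigma_additive sphere_measure.
Proof.
move=> F mF tF mUF.
pose G i := [set x | 0 < enorm x <= 1 /\ F i ((enorm x)^-1 *: x)].
rewrite /sphere_measure (_ : [set x | _] = \bigcup_i G i); last first.
  rewrite predeqE => x; split => [[x1 [i _ Fx]]|[i _ [x1 Fx]]]; first by exists i.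
  by split=> //; exists i.
under eq_fun do rewrite -ge0_sume_distrr//.
apply: cvgeZl => //; apply: measure_semi_sigma_additive => [i||].
- exact: measurable_sphere_preimage.
- apply/trivIsetP => i j _ _ ij; rewrite /G !sphere_preimage setIACA.
  rewrite setIid -preimage_setI.
  move/trivIsetP : tF => /(_ _ _ _ _ ij) ->//.
  by rewrite preimage_set0 setI0.
- by apply: bigcup_measurable => i _; exact: measurable_sphere_preimage.
Qed.

HB.instance Definition _ := isMeasure.Build _ _ _ sphere_measure
  sphere_measure0 sphere_measure_ge0 sphere_measure_sigma_additive.

Definition minkowski_sum K L : set 'rV[R]_n := [set x + y | x in K & y in L].

Definition translate K v : set 'rV[R]_n := [set x + v | x in K].

Definition polar K : set 'rV[R]_n := [set x | forall y, K y -> dot x y <= 1].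

Definition convex_body K : Prop := [/\ K !=set0, compact K & convex_set K].

Definition support_function K u : R := sup [set dot u x | x in K].

(* The integral is the real-valued one, taken coordinatewise. *)
Definition steiner_point K : 'rV[R]_n :=
  (fine (lebesgue_rV R n (eball 1)))^-1 *:
  \row_i \int[sphere_measure]_(u in unit_sphere) (support_function K u * u 0 i).

Definition hausdorff_dist K L : R :=
  inf [set r | [/\ 0 <= r, K `<=` minkowski_sum L (eball r)
                        & L `<=` minkowski_sum K (eball r)]].

Definition special_orthogonal (U : 'M[R]_n) : Prop :=
  U *m U^T = 1%:M /\ \det U = 1.

(* x *m U^T is the transpose of the column vector U *m x^T. *)
Definition linear_image (U : 'M[R]_n) K : set 'rV[R]_n :=
  [set x *m U^T | x in K].

(* A map K^n -> K^n is a map on sets preserving convex bodies; its values on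
   other sets are irrelevant. *)
Definition minkowski_endomorphism (Phi : set 'rV[R]_n -> set 'rV[R]_n) : Prop :=
  [/\ forall K, convex_body K -> convex_body (Phi K),
      forall K, convex_body K -> forall e : R, 0 < e ->
        exists2 d : R, 0 < d & forall L, convex_body L ->
          hausdorff_dist K L < d -> hausdorff_dist (Phi K) (Phi L) < e,
      forall K L, convex_body K -> convex_body L ->
        Phi (minkowski_sum K L) = minkowski_sum (Phi K) (Phi L),
      forall K v, convex_body K -> Phi (translate K v) = Phi K
    & forall K (U : 'M[R]_n), convex_body K -> special_orthogonal U ->
        Phi (linear_image U K) = linear_image U (Phi K)].

Definition weakly_monotone (Phi : set 'rV[R]_n -> set 'rV[R]_n) : Prop :=
  forall K L, convex_body K -> convex_body L ->
    steiner_point K = 0 -> steiner_point L = 0 ->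
    K `<=` L -> Phi K `<=` Phi L.

Definition J K : set 'rV[R]_n := translate K (- steiner_point K).

Definition volume_product (Phi : set 'rV[R]_n -> set 'rV[R]_n) K : \bar R :=
  (lebesgue_rV R n K * lebesgue_rV R n (polar (Phi K)))%E.

End euclidean_space.

(* Main.v *)
(* J inherits its properties from the Steiner point, for which the two
   non-formal inputs are the rotation invariance of Lebesgue measure and the
   moments \int u_i u_j = |B| delta_ij of the sphere; both follow from the
   invariance of Lebesgue measure under orthogonal matrices.
   For the unboundedness take flat pyramids of height e over a fixed cube.
   Only the directions within e of the axis see the apex, so the Steiner point
   lies at height O(e^2), relatively much closer to the base than to the apex.
   The volume of the pyramid is of order e while the polar body, which contains
   a box of height of order e^-2, has volume of order e^-2. *)
Require Import Defs.
From mathcomp Require Import all_boot all_order all_algebra.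
From mathcomp Require Import all_classical all_reals all_analysis.
From mathcomp Require Import fingroup.perm measurable_realfun ring lra.

Set Implicit Arguments.
Unset Strict Implicit.
Unset Printing Implicit Defensive.

Import Order.TTheory GRing.Theory Num.Theory.
Import numFieldNormedType.Exports.

Local Open Scope classical_set_scope.
Local Open Scope ring_scope.

(** Lebesgue measure is built as an iterated product, so box volumes, translation invariance and
    Fubini are the tools. Orthogonal invariance is obtained by comparison with the unit ball, which
    orthogonal matrices preserve, rather than through a determinant formula; it is proved for all
    orthogonal matrices because coordinate reflections and transpositions, of determinant -1, are
    used later. The factor e^2 in the height of the Steiner point has two sources. Pair each
    direction u of the upper half sphere with its mirror image u' in the base hyperplane: h(u) -
    h(u') is at most e near the pole and at most 0 elsewhere, and the directions near the poles have
    measure O(e) since there is at least one horizontal coordinate; this is where n >= 2 enters. The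
    apex stays at a height of order e above the Steiner point, so the polar body reaches as far as
    e^-2 only below the origin, and the box placed in it is one-sided. Its horizontal size does not
    depend on e, whence a volume product of order at least 1/e. *)

(** * Translation invariance on the line *)

Section lebesgue_translation.
Context (R : realType).

(** The pushforward under the translation agrees with Lebesgue measure on half-open intervals, and
    these values determine the measure. *)
Lemma lebesgue_measure_translate (a : R) (A : set (measurableTypeR R)) :
  measurable A ->
  lebesgue_measure [set x | A (x + a)] = lebesgue_measure A.
Proof.
move=> mA.
have mf : measurable_fun setT
    ((fun x => x + a) : measurableTypeR R -> measurableTypeR R).
  exact: measurable_funD.
apply/esym.
rewrite (@lebesgue_measure_unique _ (pushforward lebesgue_measure
  ((fun x => x + a) : _ -> measurableTypeR R)))//= => _ [[b c]] _ <-.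
rewrite /pushforward (_ : _ @^-1` _ = `]b - a, c - a]%classic); last first.
  by apply/seteqP; split=> x /=; rewrite !in_itv/= ltrBlDr lerBrDr.
rewrite !lebesgue_measure_itv/= !lte_fin ltrD2r.
by case: ifPn => // _; rewrite -!EFinB; congr EFin; ring.
Qed.

Lemma integral_lebesgue_translate (a : R) (g : measurableTypeR R -> \bar R) :
  measurable_fun setT g -> (forall x, 0 <= g x)%E ->
  (\int[@lebesgue_measure R]_x g (x + a)%R = \int[@lebesgue_measure R]_x g x)%E.
Proof.
move=> mg g0.
have mf : measurable_fun setT
    ((fun x => x + a) : measurableTypeR R -> measurableTypeR R).
  exact: measurable_funD.
transitivity (\int[pushforward (@lebesgue_measure R)
   ((fun x => (x + a)%R) : _ -> measurableTypeR R)]_x g x)%E.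
  by rewrite ge0_integral_pushforward// preimage_setT.
by apply: eq_measure_integral => A mA _; exact: lebesgue_measure_translate.
Qed.

End lebesgue_translation.

(** * Borel sets of R^n *)

Section rV_measurability.
Context (R : realType) (n : nat).
Implicit Types (A : set 'rV[R]_n).

Lemma measurable_preimage_rV d (T : measurableType d) (f : T -> 'rV[R]_n) A :
  (forall i, measurable_fun setT (fun t => f t 0 i)) -> measurable A ->
  measurable (f @^-1` A).
Proof.
by move=> mf mA; rewrite -[X in measurable X]setTI; exact: measurable_fun_rV.
Qed.

Lemma measurable_box (a b : 'I_n -> R) :
  measurable [set x : 'rV[R]_n | forall i, a i <= x 0 i <= b i].
Proof.
rewrite (_ : mkset _ = \bigcap_(i in [set: 'I_n])
    (@rV_coord R n i) @^-1` `[a i, b i]); last first.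
  by apply/seteqP; split=> x /= h i; [move=> _|];
    have := h i; rewrite /rV_coord /= in_itv/= => h'; apply: h'.
apply: fin_bigcap_measurable; first exact: finite_finset.
by move=> i _; rewrite -[X in measurable X]setTI; exact: measurable_rV_coord.
Qed.

(** The sigma-algebra is generated by the coordinates, so an open set is written as the union of the
    closed boxes [D p] contained in it; rational centres and radii 1/(k+1) make the union
    countable. *)
Lemma open_measurable_rV A : open A -> measurable A.
Proof.
move=> oA.
pose D (p : 'rV[rat]_n * nat) : set 'rV[R]_n :=
  [set x | forall i, ratr (p.1 0 i) - p.2.+1%:R^-1 <= x 0 i
                     <= ratr (p.1 0 i) + p.2.+1%:R^-1].
rewrite (_ : A = \bigcup_(p in [set p | D p `<=` A]) D p); last first.
  apply/seteqP; split=> [x Ax|x [p] /= DA /DA//].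
  have : nbhs x A by exact: open_nbhs_nbhs.
  move=> /nbhs_ballP[e /= e0 xeA].
  (* The factor 2 is needed because x need not be the centre: two points of a box may differ by
     twice its radius. *)
  have [k ke] : exists k : nat, 2 * k.+1%:R^-1 < e.
    have e20 : 0 < e / 2 by rewrite divr_gt0.
    have [k _ /(_ k) /= h] := near_infty_natSinv_lt (PosNum e20).
    by exists k; rewrite mulrC -ltr_pdivlMr// h//=.
  have r0 : 0 < k.+1%:R^-1 :> R by rewrite invr_gt0.
  have /choice[q qP] : forall i, exists q : rat,
      `|x 0 i - ratr q| < k.+1%:R^-1.
    move=> i; move: r0; set r := k.+1%:R^-1 => r0.
    have : x 0 i - r < x 0 i + r by lra.
    move=> /rat_in_itvoo[q]; rewrite in_itv/= => /andP[q1 q2]; exists q.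
    by rewrite ltr_norml; apply/andP; split; lra.
  have Dx : D (\row_i q i, k) x.
    move=> i /=; rewrite mxE; have := qP i.
    by rewrite ltr_norml; move: (_^-1) => r /andP[? ?]; apply/andP; split; lra.
  exists (\row_i q i, k) => //= y Dy; apply: xeA.
  split=> // i j; rewrite (ord1 i).
  have /= := Dx j; have /= := Dy j; rewrite !mxE /ball/= ltr_norml.
  by move: (_^-1) ke => r ke /andP[? ?] /andP[? ?]; apply/andP; split; lra.
rewrite bigcup_mkcond; apply: countable_bigcupT_measurable.
  exact: countableP.
move=> p; case: ifP => // _; exact: measurable_box.
Qed.

Lemma closed_measurable_rV A : closed A -> measurable A.
Proof.
move=> cA; rewrite -(setCK A); apply: measurableC.
by apply: open_measurable_rV; exact: closed_openC.
Qed.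

Lemma continuous_measurable_fun_rV (f : 'rV[R]_n -> R) :
  continuous f -> measurable_fun setT f.
Proof.
move=> /continuousP cf.
apply: (measurability _ (measurable_realfun.RGenOpens.measurableE R)).
move=> _ [_ [a [b ->] <-]]; rewrite setTI; apply: open_measurable_rV.
by apply: cf; exact: interval_open.
Qed.

End rV_measurability.

(** * Slicing, translations and boxes for Lebesgue measure on R^n *)

Section lebesgue_rV_theory.
Context (R : realType).

Lemma rV_cons0 n (t : R) (y : 'rV[R]_n) : rV_cons (t, y) 0 ord0 = t.
Proof. by have [] := rV_consK (t, y). Qed.

Lemma rV_consS n (t : R) (y : 'rV[R]_n) i : rV_cons (t, y) 0 (lift ord0 i) = y 0 i.
Proof. by have [_ /rowP/(_ i)] := rV_consK (t, y); rewrite mxE. Qed.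

Lemma rV_consP n (x : 'rV[R]_n.+1) (t : R) (y : 'rV[R]_n) :
  x 0 ord0 = t -> (forall i, x 0 (lift ord0 i) = y 0 i) -> x = rV_cons (t, y).
Proof.
move=> x0 xS; apply/rowP => i; have [j ->|->] := unliftP ord0 i.
  by rewrite xS rV_consS.
by rewrite x0 rV_cons0.
Qed.

Lemma rV_consD n (t s : R) (y z : 'rV[R]_n) :
  rV_cons (t, y) + rV_cons (s, z) = rV_cons (t + s, y + z).
Proof.
apply: rV_consP; first by rewrite mxE !rV_cons0.
by move=> i; rewrite mxE !rV_consS mxE.
Qed.

Let xsection_rV_cons n (A : set 'rV[R]_n.+1) t :
  xsection (@rV_cons R n @^-1` A) t = [set y | A (rV_cons (t, y))].
Proof. by apply/seteqP; split=> y; rewrite /xsection/= inE. Qed.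

Lemma lebesgue_rVS n (A : set 'rV[R]_n.+1) :
  lebesgue_rV R n.+1 A = (\int[@lebesgue_measure R]_t
    lebesgue_rV R n [set y | A (rV_cons (t, y))])%E.
Proof.
by apply: eq_integral => t _; rewrite /= xsection_rV_cons.
Qed.

(** Induction on the dimension: the first coordinate of [v] shifts the outer integral, the remaining
    ones shift each slice. *)
Lemma lebesgue_rV_translate n (A : set 'rV[R]_n) v : measurable A ->
  lebesgue_rV R n [set x | A (x + v)] = lebesgue_rV R n A.
Proof.
elim: n A v => [|n IH] A v mA.
  congr (lebesgue_rV R 0 _); apply/funext => x /=; congr A.
  by rewrite (thinmx0 x) thinmx0.
have mA' : measurable (@rV_cons R n @^-1` A).
  exact: measurable_preimage_rV_cons.
rewrite !lebesgue_rVS.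
set g := fun t => lebesgue_rV R n [set y | A (rV_cons (t, y))].
rewrite -(@integral_lebesgue_translate R (v 0 ord0) g)//; last first.
  rewrite (_ : g = lebesgue_rV R n \o xsection (@rV_cons R n @^-1` A)).
    exact: measurable_fun_xsection.
  by apply/funext => t; rewrite /g /= xsection_rV_cons.
apply: eq_integral => t _; rewrite /g.
rewrite -[RHS](IH _ (\row_i v 0 (lift ord0 i))); last first.
  by rewrite -xsection_rV_cons; exact: measurable_xsection.
congr (lebesgue_rV R n _); apply/funext => y /=; congr A.
by rewrite -rV_consD; congr (_ + _); apply: rV_consP => // i; rewrite mxE.
Qed.

Lemma lebesgue_rV_box n (a b : 'I_n -> R) : (forall i, a i <= b i) ->
  lebesgue_rV R n [set x | forall i, a i <= x 0 i <= b i] =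
  (\prod_i (b i - a i))%:E.
Proof.
elim: n a b => [|n IH] a b ab.
  rewrite big_ord0 /= diracE mem_set//; last by case.
rewrite big_ord_recl EFinM -IH//.
transitivity ((@lebesgue_measure R) `[a ord0, b ord0] * lebesgue_rV R n
   [set x | forall i, (a (lift ord0 i) <= x 0 i <= b (lift ord0 i))%R])%E.
  rewrite -product_measure1E//; last exact: measurable_box.
  congr (product_measure1 _ _ _); apply/seteqP; split=> [[t y] /= h|[t y] /= [ht hy] i].
    split; first by have := h ord0; rewrite rV_cons0 in_itv.
    by move=> i; have := h (lift ord0 i); rewrite rV_consS.
  by have [j ->|->] := unliftP ord0 i; rewrite ?rV_consS ?rV_cons0//.
congr (_ * _)%E; rewrite lebesgue_measure_itv/= lte_fin.
have := ab ord0; rewrite le_eqVlt => /orP[/eqP ->|-> //].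
by rewrite ltxx subrr.
Qed.

End lebesgue_rV_theory.

(** * Scalar product and Euclidean norm *)

Section euclidean.
Context (R : realType) (n : nat).
Implicit Types (x y z u v : 'rV[R]_n) (A : set 'rV[R]_n) (U : 'M[R]_n).

Lemma dotC x y : dot x y = dot y x.
Proof. by apply: eq_bigr => i _; rewrite mulrC. Qed.

Lemma dotDl x y z : dot (x + y) z = dot x z + dot y z.
Proof. by rewrite -big_split/=; apply: eq_bigr => i _; rewrite mxE mulrDl. Qed.

Lemma dotDr x y z : dot z (x + y) = dot z x + dot z y.
Proof. by rewrite dotC dotDl !(dotC z). Qed.

Lemma dotZl a x y : dot (a *: x) y = a * dot x y.
Proof. by rewrite mulr_sumr; apply: eq_bigr => i _; rewrite mxE mulrA. Qed.

Lemma dotZr a x y : dot x (a *: y) = a * dot x y.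
Proof. by rewrite dotC dotZl dotC. Qed.

Lemma dotNl x y : dot (- x) y = - dot x y.
Proof. by rewrite -scaleN1r dotZl mulN1r. Qed.

Lemma dotNr x y : dot x (- y) = - dot x y.
Proof. by rewrite dotC dotNl dotC. Qed.

Lemma dot0r x : dot x 0 = 0.
Proof. by rewrite /dot big1// => i _; rewrite mxE mulr0. Qed.

Lemma dot_ge0 x : 0 <= dot x x.
Proof. by apply: sumr_ge0 => i _; rewrite -expr2 sqr_ge0. Qed.

Lemma dotE x y : dot x y = (x *m y^T) 0 0.
Proof. by rewrite mxE; apply: eq_bigr => i _; rewrite mxE. Qed.

Lemma dot_mulmxr x y U : dot x (y *m U^T) = dot (x *m U) y.
Proof. by rewrite !dotE trmx_mul trmxK mulmxA. Qed.

Lemma dot_eq0 x : dot x x = 0 -> x = 0.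
Proof.
move/eqP; rewrite psumr_eq0; last by move=> i _; rewrite -expr2 sqr_ge0.
move=> /allP h; apply/rowP => i; rewrite mxE; apply/eqP.
by have := h i (mem_index_enum i); rewrite -expr2 sqrf_eq0.
Qed.

Lemma enorm_ge0 x : 0 <= enorm x.
Proof. exact: sqrtr_ge0. Qed.

Lemma enorm_sqr x : enorm x ^+ 2 = dot x x.
Proof. by rewrite sqr_sqrtr// dot_ge0. Qed.

Lemma enormN x : enorm (- x) = enorm x.
Proof. by rewrite /enorm dotNl dotNr opprK. Qed.

Lemma enorm0 : enorm (0 : 'rV[R]_n) = 0.
Proof. by rewrite /enorm dot0r sqrtr0. Qed.

Lemma enorm_eq0 x : enorm x = 0 -> x = 0.
Proof. by move=> x0; apply: dot_eq0; rewrite -enorm_sqr x0 expr0n. Qed.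

Lemma enormZ a x : enorm (a *: x) = `|a| * enorm x.
Proof.
by rewrite /enorm dotZl dotZr mulrA -expr2 sqrtrM ?sqr_ge0// sqrtr_sqr.
Qed.

(** Cauchy-Schwarz: the squared norm of |y| x - |x| y is 2 |x| |y| (|x| |y| - x.y), and it is
    nonnegative. *)
Lemma dot_le_enorm x y : dot x y <= enorm x * enorm y.
Proof.
have [->|x0] := eqVneq x 0; first by rewrite dotC dot0r enorm0 mul0r.
have [->|y0] := eqVneq y 0; first by rewrite dot0r enorm0 mulr0.
have ne z : z != 0 -> 0 < enorm z.
  by move=> z0; rewrite lt_def enorm_ge0 andbT; apply: contra z0 => /eqP/enorm_eq0/eqP.
have [a0 b0] := (ne _ x0, ne _ y0).
have := dot_ge0 (enorm y *: x - enorm x *: y).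
rewrite !(dotDl, dotDr, dotNl, dotNr, dotZl, dotZr) -!enorm_sqr (dotC y x).
set a := enorm x; set b := enorm y; set d := dot x y => h.
rewrite -(ler_pM2l (mulr_gt0 a0 b0)) -/a -/b; lra.
Qed.

Lemma enormD x y : enorm (x + y) <= enorm x + enorm y.
Proof.
rewrite -(ler_pXn2r (n := 2))// ?nnegrE ?addr_ge0 ?enorm_ge0//.
rewrite enorm_sqr !(dotDl, dotDr) -!enorm_sqr (dotC y x).
have := dot_le_enorm x y; lra.
Qed.

Lemma normr_coord_le_enorm x i : `|x 0 i| <= enorm x.
Proof.
rewrite -(ler_pXn2r (n := 2))// ?nnegrE ?enorm_ge0// enorm_sqr real_normK ?num_real//.
rewrite /dot (bigD1 i)//= -expr2 lerDl sumr_ge0// => j _.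
by rewrite -expr2 sqr_ge0.
Qed.

Lemma enorm_le_sum x : enorm x <= \sum_i `|x 0 i|.
Proof.
have s0 : 0 <= \sum_i `|x 0 i| by apply: sumr_ge0.
rewrite -(ler_pXn2r (n := 2))// ?nnegrE ?enorm_ge0// enorm_sqr expr2 mulr_suml.
apply: ler_sum => i _; rewrite (le_trans (ler_norm _))// normrM.
by rewrite ler_wpM2l// (bigD1 i)//= lerDl sumr_ge0.
Qed.

Lemma enorm_orthogonal x U : U *m U^T = 1%:M -> enorm (x *m U) = enorm x.
Proof. by move=> UU; rewrite /enorm -dot_mulmxr -mulmxA UU mulmx1. Qed.

End euclidean.

(** * Volume of the unit ball *)

Section unit_ball.
Context (R : realType) (n : nat).

Lemma measurable_eball (r : R) : measurable (eball r : set 'rV[R]_n).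
Proof.
rewrite (_ : eball r = @enorm R n @^-1` `]-oo, r]%classic); last first.
  by apply/seteqP; split=> x /=; rewrite in_itv.
rewrite -[X in measurable X]setTI; exact: measurable_enorm.
Qed.

Lemma measurable_unit_sphere : measurable (@unit_sphere R n).
Proof.
rewrite (_ : @unit_sphere R n = @enorm R n @^-1` [set 1])//.
rewrite -[X in measurable X]setTI; exact: measurable_enorm.
Qed.

Lemma lebesgue_eball_fin : (lebesgue_rV R n (eball 1) < +oo)%E.
Proof.
apply: (@le_lt_trans _ _ (lebesgue_rV R n
    [set x | forall i, (-1 : R) <= x 0 i <= 1])).
  apply: le_measure; rewrite ?inE; [exact: measurable_eball|exact: measurable_box|].
  move=> x /= x1 i; rewrite -ler_norml.
  by rewrite (le_trans _ x1)// normr_coord_le_enorm.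
rewrite lebesgue_rV_box ?ltry//= => _; lra.
Qed.

Lemma lebesgue_eball_gt0 : (0 < lebesgue_rV R n (eball 1))%E.
Proof.
(* The Euclidean norm is at most the sum of the n coordinates, here n/(n+1) < 1; the successor keeps
   [r] positive in dimension 0. *)
pose r : R := n.+1%:R^-1.
have r0 : 0 < r by rewrite invr_gt0.
apply: (@lt_le_trans _ _ (lebesgue_rV R n
    [set x | forall i, - r <= x 0 i <= r])).
  rewrite lebesgue_rV_box; last by move=> _; lra.
  by rewrite lte_fin prodr_gt0// => i _; lra.
apply: le_measure; rewrite ?inE; [exact: measurable_box|exact: measurable_eball|].
move=> x /= xr; rewrite /eball/= (le_trans (enorm_le_sum x))//.
apply: (@le_trans _ _ (\sum_(i < n) r)).
  by apply: ler_sum => i _; rewrite ler_norml.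
by rewrite sumr_const card_ord -mulr_natl ler_pdivrMr// mul1r ler_nat.
Qed.

Lemma lebesgue_eball_fin_num : lebesgue_rV R n (eball 1) \is a fin_num.
Proof. by rewrite ge0_fin_numE// lebesgue_eball_fin. Qed.

(** The origin is a box with all edges degenerate. This allows the cone over the whole sphere, which
    omits the origin, to be replaced by the ball. *)
Lemma lebesgue_rV_set0 : (0 < n)%N -> lebesgue_rV R n [set 0] = 0%E.
Proof.
move=> n0; rewrite (_ : [set 0] = [set x : 'rV[R]_n | forall i, (0 : R) <= x 0 i <= 0]).
  rewrite lebesgue_rV_box// (bigD1 (Ordinal n0))//= subrr mul0r//.
apply/seteqP; split=> x /= h; first by move=> i; rewrite h mxE lexx.
by apply/rowP => i; rewrite mxE; apply/eqP; rewrite eq_le andbC h.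
Qed.

End unit_ball.

(** * Orthogonal invariance of Lebesgue measure *)

Section orthogonal_invariance.
Context (R : realType) (n : nat).
Implicit Types (A B : set 'rV[R]_n) (U : 'M[R]_n).
Local Notation mu := (lebesgue_rV R n).

Lemma measurable_fun_mulmxr d (T : measurableType d) (f : T -> 'rV[R]_n) U i :
  (forall i, measurable_fun setT (fun t => f t 0 i)) ->
  measurable_fun setT (fun t => (f t *m U) 0 i).
Proof.
move=> mf; under eq_fun do rewrite mxE.
by apply: measurable_sum => j; apply: measurable_funM.
Qed.

Lemma measurable_mulmxr U :
  measurable_fun setT (fun x : 'rV[R]_n => x *m U).
Proof.
apply: measurable_fun_rV => i; apply: (@measurable_fun_mulmxr _ _ id) => j.
exact: measurable_rV_coord.
Qed.

Let measurable_fst_coord i :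
  measurable_fun setT (fun p : 'rV[R]_n * 'rV[R]_n => p.1 0 i).
Proof.
exact: (measurableT_comp (measurable_rV_coord i) measurable_fst).
Qed.

Let measurable_snd_coord i :
  measurable_fun setT (fun p : 'rV[R]_n * 'rV[R]_n => p.2 0 i).
Proof.
exact: (measurableT_comp (measurable_rV_coord i) measurable_snd).
Qed.

(* Fubini on {x in A, x + y U in B}: the sections in y are translates of
   {y | y U in B}, while x |-> x - y U turns the set into
   {x - y U in A, x in B}, whose sections in y are translates of A as A is
   symmetric and U-invariant. *)
Let eball_mul U B : U *m U^T = 1%:M -> measurable B ->
  (mu (eball 1) * mu [set x | B (x *m U)] = mu B * mu (eball 1))%E.
Proof.
move=> UU mB; set A := eball 1.
have UU' : U^T *m U = 1%:M by exact: mulmx1C.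
have mA : measurable A by exact: measurable_eball.
pose E1 : set ('rV[R]_n * 'rV[R]_n) :=
  ((fun p => p.1) @^-1` A) `&` ((fun p => p.1 + p.2 *m U) @^-1` B).
pose E2 : set ('rV[R]_n * 'rV[R]_n) :=
  ((fun p => p.1 - p.2 *m U) @^-1` A) `&` ((fun p => p.1) @^-1` B).
have mE1 : measurable E1.
  apply: measurableI; apply: measurable_preimage_rV => // i.
  under eq_fun do rewrite mxE.
  by apply: measurable_funD => //; exact: measurable_fun_mulmxr.
have mE2 : measurable E2.
  apply: measurableI; apply: measurable_preimage_rV => // i.
  under eq_fun do rewrite !mxE.
  apply: measurable_funB => //.
  by have := @measurable_fun_mulmxr _ _ snd U i measurable_snd_coord;
    under eq_fun do rewrite mxE.
have mBU : measurable [set x : 'rV[R]_n | B (x *m U)].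
  by rewrite -[X in measurable X]setTI; exact: measurable_mulmxr.
rewrite -!product_measure1E//.
transitivity ((mu \x mu)%E E1).
  apply: eq_integral => x _ /=; rewrite -[LHS](@lebesgue_rV_translate _ _ _ (x *m U^T)).
    congr (mu _); apply/seteqP; split=> y; rewrite /xsection /= !inE /E1/=;
    by rewrite mulmxDl -mulmxA UU' mulmx1 addrC.
  by apply: measurable_xsection; exact: measurableX.
transitivity ((mu \x mu)%E E2); last first.
  apply: eq_integral => x _ /=.
  rewrite -[RHS](@lebesgue_rV_translate _ _ _ (- (x *m U^T))).
    congr (mu _); apply/seteqP; split=> y; rewrite /xsection /= !inE /E2/=;
    rewrite /A /eball /= -[enorm (_ - x *m _)](enorm_orthogonal _ UU);
    rewrite mulmxBl -mulmxA UU' mulmx1.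
      by rewrite -enormN opprB => -[].
    by move=> [Bx yx]; rewrite -enormN opprB.
  by apply: measurable_xsection; exact: measurableX.
(* Both orders of integration give the same measure, since they agree on rectangles. *)
have E : forall X, measurable X -> (mu \x mu)%E X = (mu \x^ mu)%E X.
  by apply: product_measure_unique => *; exact: product_measure2E.
rewrite !E//; apply: eq_integral => y _ /=.
rewrite -[LHS](@lebesgue_rV_translate _ _ _ (- (y *m U))).
  by congr (mu _); apply/seteqP; split=> x; rewrite /ysection /= !inE /E1/E2/= subrK.
exact: measurable_ysection.
Qed.

(** The volume of the unit ball is finite and positive, so it cancels from the identity
    [eball_mul]. *)
Lemma lebesgue_rV_orthogonal U B : U *m U^T = 1%:M -> measurable B ->
  mu [set x | B (x *m U)] = mu B.
Proof.
move=> UU mB; have h := eball_mul UU mB; rewrite muleC in h.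
have [fb b0] := (lebesgue_eball_fin_num R n, lebesgue_eball_gt0 R n).
by apply/eqP; rewrite eq_le; apply/andP; split; rewrite -(lee_pmul2r fb b0) h.
Qed.

End orthogonal_invariance.

(** * Spherical measure *)

Section sphere_measure_theory.
Context (R : realType) (n : nat).
Implicit Types (A B : set 'rV[R]_n) (U : 'M[R]_n).
Local Notation mu := (lebesgue_rV R n).
Local Notation sigma := (@sphere_measure R n).

Lemma sphere_measure_orthogonal U B : U *m U^T = 1%:M -> measurable B ->
  sigma [set x | B (x *m U)] = sigma B.
Proof.
move=> UU mB; rewrite /sphere_measure; congr (_ * _)%E.
rewrite -[RHS](lebesgue_rV_orthogonal UU)//; last exact: measurable_sphere_preimage.
by congr (mu _); apply/funext => x /=; rewrite enorm_orthogonal// -scalemxAl.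
Qed.

Lemma sphere_measure_unit_sphere : (0 < n)%N ->
  sigma (@unit_sphere R n) = (n%:R%:E * mu (eball 1))%E.
Proof.
move=> n0; rewrite /sphere_measure; congr (_ * _)%E.
rewrite (_ : mkset _ = eball 1 `\` [set 0]); last first.
  apply/seteqP; split=> x /=.
    by move=> [/andP[x0 x1] _]; split=> // xE; rewrite xE enorm0 ltxx in x0.
  move=> [x1 /eqP x0]; have ex0 : 0 < enorm x.
    by rewrite lt_def enorm_ge0 andbT; apply: contra x0 => /eqP/enorm_eq0/eqP.
  split; first by rewrite ex0.
  by rewrite /unit_sphere/= enormZ gtr0_norm ?invr_gt0// mulVf ?gt_eqF.
rewrite measureD//; [|exact: measurable_eball| |exact: lebesgue_eball_fin].
- rewrite [X in (_ - mu X)%E]setIidr ?lebesgue_rV_set0 ?sube0// => x ->.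
  by rewrite /eball/= enorm0.
- apply: closed_measurable_rV.
  exact/accessible_closed_set1/hausdorff_accessible/norm_hausdorff.
Qed.

Lemma sphere_measure_fin : (sigma (@unit_sphere R n) < +oo)%E.
Proof.
rewrite /sphere_measure; apply: (@le_lt_trans _ _ (n%:R%:E * mu (eball 1))%E).
  apply: lee_wpmul2l => //; apply: le_measure; rewrite ?inE.
  - by apply: measurable_sphere_preimage; exact: measurable_unit_sphere.
  - exact: measurable_eball.
  - by move=> x [/andP[]].
by rewrite lte_mul_pinfty// ?lebesgue_eball_fin// lee_fin.
Qed.

Lemma sphere_integrable (c : R) (f : 'rV[R]_n -> R) : measurable_fun setT f ->
  (forall u, unit_sphere u -> `|f u| <= c) ->
  sigma.-integrable (@unit_sphere R n) (EFin \o f).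
Proof.
move=> mf fc; apply: measurable_bounded_integrable.
- exact: measurable_unit_sphere.
- exact: sphere_measure_fin.
- exact: measurable_funTS.
- by exists c; split=> [|x cx u /fc /le_trans]; [exact: num_real|apply; exact: ltW].
Qed.

(** Change of variables along x -> x U, which preserves both the sphere and its measure; boundedness
    supplies the integrability. *)
Lemma sphere_integral_orthogonal U (c : R) (f : 'rV[R]_n -> R) :
  U *m U^T = 1%:M -> measurable_fun setT f ->
  (forall u, unit_sphere u -> `|f u| <= c) ->
  \int[sigma]_(u in @unit_sphere R n) f (u *m U) =
  \int[sigma]_(u in @unit_sphere R n) f u.
Proof.
move=> UU mf fc; have UU' : U^T *m U = 1%:M by exact: mulmx1C.
have mU := @measurable_mulmxr R n U.
have SU V : V *m V^T = 1%:M ->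
    (fun x => x *m V) @^-1` @unit_sphere R n = @unit_sphere R n.
  by move=> VV; apply/funext => x; rewrite /unit_sphere/= enorm_orthogonal.
congr fine; apply/esym.
transitivity (\int[pushforward sigma (fun x => x *m U)]_(u in @unit_sphere R n)
    (f u)%:E)%E.
  apply: eq_measure_integral => A mA _.
  by rewrite -[LHS](sphere_measure_orthogonal UU).
rewrite (@integral_pushforward _ _ _ _ _ (fun x => x *m U))//.
- by rewrite SU.
- exact/measurable_EFinP.
- rewrite SU//; apply: (@sphere_integrable c (fun x => f (x *m U))).
    exact: measurableT_comp.
  by move=> u; rewrite -{1}(SU _ UU); exact: fc.
- exact: measurable_unit_sphere.
Qed.

End sphere_measure_theory.

(** * Integrals over the sphere and its second moments *)

Section sphere_bounded.
Context (R : realType) (n : nat).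
Implicit Types (f g : 'rV[R]_n -> R) (U : 'M[R]_n).
Local Notation S := (@unit_sphere R n).
Local Notation sigma := (@sphere_measure R n).
Local Notation b := (fine (lebesgue_rV R n (eball 1))).

(** A class of integrands that is stable under sums, products and orthogonal substitutions and
    consists of integrable functions, the sphere having finite measure. It settles integrability
    once for all later integrals. *)
Definition sphere_bounded f :=
  measurable_fun setT f /\ exists c, forall u, S u -> `|f u| <= c.

Lemma sphere_bounded_integrable f : sphere_bounded f ->
  sigma.-integrable S (EFin \o f).
Proof. by move=> [mf [c]]; exact: sphere_integrable. Qed.

Lemma sphere_boundedD f g : sphere_bounded f -> sphere_bounded g ->
  sphere_bounded (fun u => f u + g u).
Proof.
move=> [mf [c fc]] [mg [d gd]]; split; first exact: measurable_funD.
exists (c + d) => u Su; rewrite (le_trans (ler_normD _ _))//.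
by rewrite lerD ?fc ?gd.
Qed.

Lemma sphere_boundedM f g : sphere_bounded f -> sphere_bounded g ->
  sphere_bounded (fun u => f u * g u).
Proof.
move=> [mf [c fc]] [mg [d gd]]; split; first exact: measurable_funM.
by exists (c * d) => u Su; rewrite normrM ler_pM ?fc ?gd.
Qed.

Lemma sphere_bounded_cst c : sphere_bounded (fun=> c).
Proof. by split; [exact: measurable_cst|exists `|c|]. Qed.

Lemma sphere_boundedZ c f : sphere_bounded f -> sphere_bounded (fun u => c * f u).
Proof. by apply: sphere_boundedM; exact: sphere_bounded_cst. Qed.

Lemma sphere_boundedN f : sphere_bounded f -> sphere_bounded (fun u => - f u).
Proof.
by move=> /(sphere_boundedZ (- 1)); under eq_fun do rewrite mulN1r.
Qed.

Lemma sphere_bounded_coord i : sphere_bounded (fun u => u 0 i).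
Proof.
split; first exact: measurable_rV_coord.
by exists 1 => u /= <-; exact: normr_coord_le_enorm.
Qed.

Lemma sphere_bounded_orthogonal U f : U *m U^T = 1%:M ->
  sphere_bounded f -> sphere_bounded (fun u => f (u *m U)).
Proof.
move=> UU [mf [c fc]]; split.
  by apply: measurableT_comp => //; exact: measurable_mulmxr.
by exists c => u Su; apply: fc; rewrite /unit_sphere/= enorm_orthogonal.
Qed.

Lemma sphere_bounded_sum (I : Type) (r : seq I) (F : I -> 'rV[R]_n -> R) :
  (forall i, sphere_bounded (F i)) -> sphere_bounded (fun u => \sum_(i <- r) F i u).
Proof.
move=> hF; elim: r => [|i r IH].
  by under eq_fun do rewrite big_nil; exact: sphere_bounded_cst.
by under eq_fun do rewrite big_cons; exact: sphere_boundedD.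
Qed.

Lemma sphere_integral_sum (I : Type) (r : seq I) (F : I -> 'rV[R]_n -> R) :
  (forall i, sphere_bounded (F i)) ->
  \int[sigma]_(u in S) (\sum_(i <- r) F i u) =
  \sum_(i <- r) \int[sigma]_(u in S) F i u.
Proof.
move=> hF; elim: r => [|i r IH].
  under eq_Rintegral do rewrite big_nil.
  by rewrite big_nil Rintegral_cst ?mul0r//; exact: measurable_unit_sphere.
under eq_Rintegral do rewrite big_cons.
rewrite big_cons -IH RintegralD//.
- exact: measurable_unit_sphere.
- exact: sphere_bounded_integrable.
- by apply: sphere_bounded_integrable; exact: sphere_bounded_sum.
Qed.

Lemma sphere_integralZ c f : sphere_bounded f ->
  \int[sigma]_(u in S) (c * f u) = c * \int[sigma]_(u in S) f u.
Proof.
move=> hf; apply: RintegralZl; first exact: measurable_unit_sphere.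
exact: sphere_bounded_integrable.
Qed.

Lemma sphere_integralD f g : sphere_bounded f -> sphere_bounded g ->
  \int[sigma]_(u in S) (f u + g u) =
  \int[sigma]_(u in S) f u + \int[sigma]_(u in S) g u.
Proof.
move=> hf hg; apply: RintegralD; first exact: measurable_unit_sphere.
all: exact: sphere_bounded_integrable.
Qed.

Lemma sphere_integral_invariant U f : U *m U^T = 1%:M -> sphere_bounded f ->
  \int[sigma]_(u in S) f (u *m U) = \int[sigma]_(u in S) f u.
Proof. by move=> UU [mf [c fc]]; exact: (sphere_integral_orthogonal UU mf fc). Qed.

Lemma le_sphere_integral f g : sphere_bounded f -> sphere_bounded g ->
  (forall u, S u -> f u <= g u) ->
  \int[sigma]_(u in S) f u <= \int[sigma]_(u in S) g u.
Proof.
move=> hf hg; apply: le_Rintegral; first exact: measurable_unit_sphere.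
all: exact: sphere_bounded_integrable.
Qed.

Lemma ball_volume_gt0 : 0 < b.
Proof. by rewrite fine_gt0// lebesgue_eball_gt0 lebesgue_eball_fin. Qed.

Hypothesis n0 : (0 < n)%N.

Lemma sphere_integral_cst c : \int[sigma]_(u in S) c = c * (n%:R * b).
Proof.
rewrite Rintegral_cst; last exact: measurable_unit_sphere.
by rewrite /= sphere_measure_unit_sphere// fineM// lebesgue_eball_fin_num.
Qed.

Lemma normr_sphere_integral_le f c : sphere_bounded f ->
  (forall u, S u -> `|f u| <= c) ->
  `|\int[sigma]_(u in S) f u| <= c * (n%:R * b).
Proof.
move=> hf fc; rewrite -sphere_integral_cst ler_norml; apply/andP; split.
  rewrite -mulN1r -sphere_integralZ; last exact: sphere_bounded_cst.
  apply: le_sphere_integral => //; first exact/sphere_boundedZ/sphere_bounded_cst.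
  by move=> u /fc; rewrite mulN1r ler_norml => /andP[].
apply: le_sphere_integral => //; first exact: sphere_bounded_cst.
by move=> u /fc; rewrite ler_norml => /andP[].
Qed.

Definition reflection (i : 'I_n) : 'M[R]_n :=
  diag_mx (\row_k (-1) ^+ (k == i)).

Lemma mul_reflection (u : 'rV[R]_n) i k :
  (u *m reflection i) 0 k = (-1) ^+ (k == i) * u 0 k.
Proof. by rewrite mul_mx_diag !mxE mulrC. Qed.

Lemma reflection_orthogonal i : reflection i *m (reflection i)^T = 1%:M.
Proof.
rewrite tr_diag_mx mulmx_diag -diag_const_mx; congr diag_mx.
by apply/rowP => k; rewrite !mxE -signr_addb addbb.
Qed.

(** Reflecting the i-th coordinate preserves the integral and changes the sign of the integrand. *)
Lemma sphere_moment_offdiag i j : i != j ->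
  \int[sigma]_(u in S) (u 0 i * u 0 j) = 0.
Proof.
move=> ij; have hf : sphere_bounded (fun u => u 0 i * u 0 j).
  by apply: sphere_boundedM; exact: sphere_bounded_coord.
have := sphere_integral_invariant (reflection_orthogonal i) hf.
under eq_Rintegral do rewrite !mul_reflection eqxx eq_sym (negbTE ij) mul1r expr1
  mulN1r mulNr -mulN1r.
rewrite sphere_integralZ// mulN1r => h; lra.
Qed.

(** Transpositions of coordinates make the n diagonal moments equal, and their sum is the integral
    of |u|^2 = 1, the total measure n |B|. *)
Lemma sphere_moment_diag i : \int[sigma]_(u in S) (u 0 i * u 0 i) = b.
Proof.
have hf j : sphere_bounded (fun u => u 0 j * u 0 j).
  by apply: sphere_boundedM; exact: sphere_bounded_coord.
have E j : \int[sigma]_(u in S) (u 0 j * u 0 j) =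
    \int[sigma]_(u in S) (u 0 i * u 0 i).
  have UU : perm_mx (tperm i j) *m (perm_mx (tperm i j))^T = 1%:M :> 'M[R]_n.
    by rewrite tr_perm_mx -perm_mxM mulgV perm_mx1.
  rewrite -(sphere_integral_invariant UU (hf i)).
  apply: eq_Rintegral => u _.
  by rewrite -{1 2}tpermV -col_permE mxE tpermL.
have := sphere_integral_sum (index_enum 'I_n) hf.
rewrite (eq_bigr _ (fun j _ => E j)) sumr_const card_ord.
rewrite (@eq_Rintegral _ _ _ _ _ (fun=> 1)); last first.
  by move=> u; rewrite inE => /= Su; rewrite -[LHS]/(dot u u) -enorm_sqr Su expr1n.
rewrite sphere_integral_cst mul1r -[RHS]mulr_natl => /mulfI -> //.
by rewrite pnatr_eq0 -lt0n.
Qed.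

End sphere_bounded.

(** * Support functions *)

Section support_function.
Context (R : realType) (n : nat).
Implicit Types (u v x : 'rV[R]_n) (K L : set 'rV[R]_n) (U : 'M[R]_n).

Lemma compact_enorm_bounded K : compact K ->
  exists2 M : R, 0 <= M & forall x, K x -> enorm x <= M.
Proof.
move=> /compact_bounded[M [_ KM]]; exists (n%:R * (`|M| + 1)).
  by rewrite mulr_ge0// addr_ge0.
move=> x /(KM (`|M| + 1)) h; rewrite (le_trans (enorm_le_sum x))//.
apply: (@le_trans _ _ (\sum_(i < n) (`|M| + 1))); last first.
  by rewrite sumr_const card_ord mulr_natl.
apply: ler_sum => i _; apply: le_trans (h _); last by rewrite ltr_pwDr// ler_norm.
rewrite [leRHS]/Num.norm /= mx_normrE; apply/bigmax_geP; right => /=.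
by exists (0, i).
Qed.

Let has_ubound_dot K u : compact K -> has_ubound [set dot u x | x in K].
Proof.
move=> /compact_enorm_bounded[M M0 KM]; exists (enorm u * M) => _ [x Kx <-].
by rewrite (le_trans (dot_le_enorm _ _))// ler_wpM2l ?enorm_ge0// KM.
Qed.

Lemma dot_le_support_function K u x : compact K -> K x ->
  dot u x <= support_function K u.
Proof. by move=> cK Kx; apply: ub_le_sup; [exact: has_ubound_dot|exists x]. Qed.

Lemma support_function_le K u c : K !=set0 ->
  (forall x, K x -> dot u x <= c) -> support_function K u <= c.
Proof.
move=> [x Kx] Kc; apply: ge_sup; first by exists (dot u x); exists x.
by move=> _ [y Ky <-]; exact: Kc.
Qed.

Lemma support_function_set1 v u : support_function [set v] u = dot u v.
Proof. by rewrite /support_function image_set1 sup1. Qed.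

Lemma support_function_minkowski_sum K L u : convex_body K -> convex_body L ->
  support_function (minkowski_sum K L) u = support_function K u + support_function L u.
Proof.
move=> [[k0 Kk0] cK _] [[l0 Ll0] cL _]; rewrite /support_function -sup_sumE.
- congr sup; apply/seteqP; split=> [_ [_ [k Kk [l Ll <-]] <-]|_ [_ [k Kk <-] [_ [l Ll <-]] <-]].
    exists (dot u k); first by exists k.
    by exists (dot u l); [exists l|rewrite dotDr].
  exists (k + l); last by rewrite dotDr.
  by exists k => //; exists l.
- by split; [exists (dot u k0); exists k0|exact: has_ubound_dot].
- by split; [exists (dot u l0); exists l0|exact: has_ubound_dot].
Qed.

Lemma support_function_linear_image K U u :
  support_function (linear_image U K) u = support_function K (u *m U).
Proof.
congr sup; apply/seteqP; split=> [_ [_ [x Kx <-] <-]|_ [x Kx <-]].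
  by exists x => //; rewrite dot_mulmxr.
by exists (x *m U^T); [exists x|rewrite dot_mulmxr].
Qed.

Lemma support_functionD_le K u v : K !=set0 -> compact K ->
  support_function K (u + v) <= support_function K u + support_function K v.
Proof.
move=> K0 cK; apply: support_function_le => // x Kx.
by rewrite dotDl lerD// dot_le_support_function.
Qed.

Lemma normr_support_function_le K M u : K !=set0 -> compact K ->
  (forall x, K x -> enorm x <= M) -> `|support_function K u| <= enorm u * M.
Proof.
move=> K0 cK KM; have [x Kx] := K0.
rewrite ler_norml; apply/andP; split; last first.
  apply: support_function_le => // y Ky; rewrite (le_trans (dot_le_enorm _ _))//.
  by rewrite ler_wpM2l ?enorm_ge0// KM.
apply: le_trans (dot_le_support_function u cK Kx).
rewrite lerNl -dotNl (le_trans (dot_le_enorm _ _))// enormN.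
by rewrite ler_wpM2l ?enorm_ge0// KM.
Qed.

(** By subadditivity h(u) - h(v) <= h(u - v) <= |u - v| M, where M bounds the norms in K; the factor
    n converts the Euclidean norm to the maximum norm that defines the topology. *)
Lemma continuous_support_function K : K !=set0 -> compact K ->
  continuous (support_function K).
Proof.
move=> K0 cK; have [M M0 KM] := compact_enorm_bounded cK.
have lip u v : support_function K u - support_function K v <= n%:R * `|u - v| * M.
  rewrite lerBlDl -{1}(subrK v u) addrC (le_trans (support_functionD_le _ _ K0 cK))//.
  rewrite lerD2l (le_trans (ler_norm _))//.
  rewrite (le_trans (normr_support_function_le _ K0 cK KM))// ler_wpM2r//.
  rewrite (le_trans (enorm_le_sum _))//.
  apply: (@le_trans _ _ (\sum_(i < n) `|u - v|)); last first.
    by rewrite sumr_const card_ord mulr_natl.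
  apply: ler_sum => i _; rewrite [leRHS]/Num.norm /= mx_normrE.
  by apply/bigmax_geP; right => /=; exists (0, i).
move=> u; apply/(@cvgrPdist_le _ _ _ _ (nbhs_filter u)) => e e0.
(* The summand 1 keeps the denominator positive when M = 0. *)
have d0 : 0 < e / (n%:R * M + 1) by rewrite divr_gt0// ltr_wpDl// mulr_ge0.
apply: filterS (nbhsx_ballx u _ d0) => v; rewrite mx_norm_ball /ball_/= => duv.
have uv : n%:R * `|u - v| * M <= e.
  move: duv; rewrite ltr_pdivlMr; last by rewrite ltr_wpDl// mulr_ge0.
  have := normr_ge0 (u - v); lra.
rewrite ler_norml lerNl opprB !(le_trans (lip _ _))//.
by rewrite -normrN opprB.
Qed.

Lemma sphere_bounded_support_function K : K !=set0 -> compact K ->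
  sphere_bounded (support_function K).
Proof.
move=> K0 cK; split.
  by apply: continuous_measurable_fun_rV; exact: continuous_support_function.
have [M M0 KM] := compact_enorm_bounded cK.
by exists M => u Su; rewrite (le_trans (normr_support_function_le _ K0 cK KM))// Su mul1r.
Qed.

End support_function.

(** * The Steiner point: additivity, equivariance, Lipschitz bound *)

Section steiner.
Context (R : realType) (n : nat).
Hypothesis n0 : (0 < n)%N.
Implicit Types (u v x : 'rV[R]_n) (K L : set 'rV[R]_n) (U : 'M[R]_n).
Local Notation S := (@unit_sphere R n).
Local Notation sigma := (@sphere_measure R n).
Local Notation b := (fine (lebesgue_rV R n (eball 1))).

Lemma steiner_pointE K i : steiner_point K 0 i =
  b^-1 * \int[sigma]_(u in S) (support_function K u * u 0 i).
Proof. by rewrite /steiner_point !mxE. Qed.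

Let sphere_bounded_steiner K i : K !=set0 -> compact K ->
  sphere_bounded (fun u => support_function K u * u 0 i).
Proof.
move=> K0 cK; apply: sphere_boundedM; last exact: sphere_bounded_coord.
exact: sphere_bounded_support_function.
Qed.

Lemma steiner_point_minkowski_sum K L : convex_body K -> convex_body L ->
  steiner_point (minkowski_sum K L) = steiner_point K + steiner_point L.
Proof.
move=> hK hL; have [[K0 cK _] [L0 cL _]] := (hK, hL).
apply/rowP => i; rewrite [RHS]mxE !steiner_pointE -mulrDr; congr (_ * _).
rewrite -sphere_integralD; [|exact: sphere_bounded_steiner..].
by apply: eq_Rintegral => u _; rewrite support_function_minkowski_sum// mulrDl.
Qed.

(** The support function of a point is linear, so the integral applies the matrix of second moments,
    |B| times the identity, to [v]. With additivity this gives equivariance under translations. *)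
Lemma steiner_point_set1 v : steiner_point [set v] = v.
Proof.
apply/rowP => i; rewrite steiner_pointE.
have hc j : sphere_bounded (fun u : 'rV[R]_n => u 0 j * u 0 i).
  by apply: sphere_boundedM; exact: sphere_bounded_coord.
transitivity (b^-1 * \int[sigma]_(u in S) \sum_j v 0 j * (u 0 j * u 0 i)).
  congr (_ * _); apply: eq_Rintegral => u _.
  rewrite support_function_set1 mulr_suml; apply: eq_bigr => j _; ring.
rewrite sphere_integral_sum; last by move=> j; exact: sphere_boundedZ.
rewrite (bigD1 i)//= big1 => [|j ji]; rewrite sphere_integralZ//.
  by rewrite sphere_moment_diag// addr0 mulrCA mulVf ?mulr1// gt_eqF// ball_volume_gt0.
by rewrite sphere_moment_offdiag ?mulr0.
Qed.

(** The support function of the image at u is that of [K] at u U. Writing u as (u U) U^T makes the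
    whole integrand a function of u U, to which invariance of the integral applies. *)
Lemma steiner_point_orthogonal K U : U *m U^T = 1%:M -> K !=set0 -> compact K ->
  steiner_point (linear_image U K) = steiner_point K *m U^T.
Proof.
move=> UU K0 cK; apply/rowP => i; rewrite steiner_pointE mxE.
have hK j := sphere_bounded_steiner j K0 cK.
pose f u := \sum_j U i j * (support_function K u * u 0 j).
have hf : sphere_bounded f.
  by apply: sphere_bounded_sum => j; exact: sphere_boundedZ.
transitivity (b^-1 * \int[sigma]_(u in S) f (u *m U)).
  congr (_ * _); apply: eq_Rintegral => u _.
  rewrite support_function_linear_image /f -{2}(mulmx1 u) -UU mulmxA mxE mulr_sumr.
  by apply: eq_bigr => j _; rewrite [U^T j i]mxE; ring.
rewrite sphere_integral_invariant// sphere_integral_sum; last first.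
  by move=> j; exact: sphere_boundedZ.
rewrite mulr_sumr; apply: eq_bigr => j _.
by rewrite sphere_integralZ// steiner_pointE mxE; ring.
Qed.

(** The total measure n |B| of the sphere meets the normalisation 1/|B|, which leaves n; the
    coordinate factor is at most 1. *)
Lemma normr_sphere_mean_le (f : 'rV[R]_n -> R) i (c : R) : sphere_bounded f ->
  (forall u, S u -> `|f u| <= c) ->
  `|b^-1 * \int[sigma]_(u in S) (f u * u 0 i)| <= c * n%:R.
Proof.
move=> hf fc; have b0 := ball_volume_gt0 R n.
rewrite normrM gtr0_norm ?invr_gt0// ler_pdivrMl// [leRHS]mulrC -mulrA.
apply: normr_sphere_integral_le => //.
  by apply: sphere_boundedM => //; exact: sphere_bounded_coord.
move=> u Su; rewrite normrM -[c]mulr1 ler_pM ?fc//.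
by rewrite (le_trans (normr_coord_le_enorm u i)) ?Su.
Qed.

Lemma normr_steiner_point_le K i (c : R) : K !=set0 -> compact K ->
  (forall u, S u -> `|support_function K u| <= c) ->
  `|steiner_point K 0 i| <= c * n%:R.
Proof.
move=> K0 cK Kc; rewrite steiner_pointE; apply: normr_sphere_mean_le => //.
exact: sphere_bounded_support_function.
Qed.

Lemma support_function_sub_eball K L r u : L !=set0 -> compact L -> K !=set0 ->
  K `<=` minkowski_sum L (eball r) -> S u ->
  support_function K u <= support_function L u + r.
Proof.
move=> L0 cL K0 KL Su; apply: support_function_le => // x /KL[y Ly [z zr <-]].
rewrite dotDr lerD ?dot_le_support_function//.
by rewrite (le_trans (dot_le_enorm _ _))// Su mul1r.
Qed.

(** The two support functions differ by at most r on the sphere, so each coordinate of the Steiner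
    points differs by at most n r; summing over the coordinates gives the second factor n. *)
Lemma steiner_point_lipschitz K L r : convex_body K -> convex_body L ->
  K `<=` minkowski_sum L (eball r) -> L `<=` minkowski_sum K (eball r) ->
  enorm (steiner_point K - steiner_point L) <= n%:R * n%:R * r.
Proof.
move=> [K0 cK _] [L0 cL _] KL LK; rewrite (le_trans (enorm_le_sum _))//.
apply: (@le_trans _ _ (\sum_(i < n) (r * n%:R))); last first.
  by rewrite sumr_const card_ord -[leLHS]mulr_natr -mulrA mulrC.
have [hK hL] := (sphere_bounded_support_function K0 cK,
                 sphere_bounded_support_function L0 cL).
apply: ler_sum => i _.
have -> : (steiner_point K - steiner_point L) 0 i =
    steiner_point K 0 i - steiner_point L 0 i by rewrite mxE [X in _ + X]mxE.
rewrite !steiner_pointE -mulrBr.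
have -> : \int[sigma]_(u in S) (support_function K u * u 0 i) -
    \int[sigma]_(u in S) (support_function L u * u 0 i) =
    \int[sigma]_(u in S) ((support_function K u - support_function L u) * u 0 i).
  rewrite -mulN1r -sphere_integralZ; last exact: sphere_bounded_steiner.
  rewrite -sphere_integralD; last 2 first.
  - exact: sphere_bounded_steiner.
  - by apply: sphere_boundedZ; exact: sphere_bounded_steiner.
  by apply: eq_Rintegral => u _; ring.
apply: normr_sphere_mean_le.
  by apply: sphere_boundedD => //; exact: sphere_boundedN.
move=> u Su; rewrite ler_norml lerNl opprB !lerBlDl.
by rewrite !support_function_sub_eball.
Qed.

End steiner.

(** * The map J as a weakly monotone Minkowski endomorphism *)

Section endomorphism.
Context (R : realType) (n : nat).
Hypothesis n0 : (0 < n)%N.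
Implicit Types (u v x : 'rV[R]_n) (K L : set 'rV[R]_n) (U : 'M[R]_n).

Lemma convex_setP K : convex_set K <->
  (forall x y (t : R), K x -> K y -> 0 <= t <= 1 -> K (t *: x + (1 - t) *: y)).
Proof.
split=> [cK x y t Kx Ky /andP[t0 t1]|cK x y t]; last first.
  by rewrite !inE => Kx Ky; apply: cK => //; rewrite ge0 le1.
by have := cK x y (Itv01 t0 t1); rewrite !inE; exact.
Qed.

Lemma translateE K v : translate K v = minkowski_sum K [set v].
Proof.
apply/seteqP; split=> [_ [x Kx <-]|_ [x Kx [_ -> <-]]]; last by exists x.
by exists x => //; exists v.
Qed.

Lemma convex_body_set1 v : convex_body [set v].
Proof.
split; [by exists v|exact: compact_set1|].
by apply/convex_setP => x y t /= -> -> _; rewrite -scalerDl subrKC scale1r.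
Qed.

Lemma convex_body_translate K v : convex_body K -> convex_body (translate K v).
Proof.
move=> [[x Kx] cK vK]; split; first by exists (x + v); exists x.
  apply: continuous_compact cK; apply: continuous_subspaceT => y.
  by apply: (@continuousD R 'rV[R]_n 'rV[R]_n id (cst v)); [exact: id|exact: cst_continuous].
apply/convex_setP => _ _ t [y Ky <-] [z Kz <-] t01.
exists (t *: y + (1 - t) *: z); first by move/convex_setP : vK; exact.
by rewrite !scalerDr addrACA -[in RHS]scalerDl subrKC scale1r.
Qed.

Lemma steiner_point_translate K v : convex_body K ->
  steiner_point (translate K v) = steiner_point K + v.
Proof.
move=> hK; rewrite translateE steiner_point_minkowski_sum//.
  by rewrite steiner_point_set1.
exact: convex_body_set1.
Qed.

Lemma J_minkowski_sum K L : convex_body K -> convex_body L ->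
  J (minkowski_sum K L) = minkowski_sum (J K) (J L).
Proof.
move=> hK hL; rewrite /J steiner_point_minkowski_sum// opprD.
apply/seteqP; split=> [_ [_ [x Kx [y Ly <-]] <-]|_ [_ [x Kx <-] [_ [y Ly <-] <-]]].
  exists (x - steiner_point K); first by exists x.
  by exists (y - steiner_point L); [exists y|rewrite addrACA].
by exists (x + y); [exists x => //; exists y|rewrite addrACA].
Qed.

Lemma J_translate K v : convex_body K -> J (translate K v) = J K.
Proof.
move=> hK; rewrite /J steiner_point_translate// opprD.
apply/seteqP; split=> [_ [_ [x Kx <-] <-]|_ [x Kx <-]].
  by exists x => //; rewrite addrACA subrr addr0.
by exists (x + v); [exists x|rewrite addrACA subrr addr0].
Qed.

Lemma J_orthogonal K U : convex_body K -> U *m U^T = 1%:M ->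
  J (linear_image U K) = linear_image U (J K).
Proof.
move=> [K0 cK _] UU; rewrite /J steiner_point_orthogonal//.
apply/seteqP; split=> [_ [_ [x Kx <-] <-]|_ [_ [x Kx <-] <-]].
  by exists (x - steiner_point K); [exists x|rewrite mulmxBl].
by exists (x *m U^T); [exists x|rewrite mulmxBl].
Qed.

Let hausdorff_set K L : set R := [set r | [/\ 0 <= r, K `<=` minkowski_sum L (eball r)
                        & L `<=` minkowski_sum K (eball r)]].

(** Extracting a radius from the infimum requires that some radius be admissible; the sum of norm
    bounds for the two bodies is one. *)
Lemma hausdorff_dist_lt K L d : convex_body K -> convex_body L ->
  hausdorff_dist K L < d ->
  exists r, [/\ 0 <= r, r < d, K `<=` minkowski_sum L (eball r)
              & L `<=` minkowski_sum K (eball r)].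
Proof.
move=> [[x Kx] cK _] [[y Ly] cL _] KLd.
suff [r [r0 KL LK] rd] : exists2 r, hausdorff_set K L r & r < d by exists r.
apply: inf_lt KLd.
have [M M0 KM] := compact_enorm_bounded cK.
have [N N0 LN] := compact_enorm_bounded cL.
have bd z w : enorm z <= M -> enorm w <= N -> enorm (z - w) <= M + N.
  by move=> zM wN; rewrite (le_trans (enormD _ _))// enormN lerD.
exists (M + N); split; first exact: addr_ge0.
  by move=> z Kz; exists y => //; exists (z - y);
    rewrite /eball/= ?bd ?KM ?LN// addrC subrK.
move=> z Lz; exists x => //; exists (z - x); last by rewrite addrC subrK.
by rewrite /eball/= -enormN opprB bd ?KM ?LN.
Qed.

Lemma hausdorff_dist_le K L r : 0 <= r ->
  K `<=` minkowski_sum L (eball r) -> L `<=` minkowski_sum K (eball r) ->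
  hausdorff_dist K L <= r.
Proof. by move=> r0 KL LK; apply: ge_inf => //; exists 0 => s []. Qed.

(** The displacement between the Steiner points, at most n^2 r, adds to the original r. Hence J is
    Lipschitz with constant 1 + n^2. *)
Let J_sub_eball K L r : convex_body K -> convex_body L ->
  K `<=` minkowski_sum L (eball r) -> L `<=` minkowski_sum K (eball r) ->
  J K `<=` minkowski_sum (J L) (eball ((1 + n%:R * n%:R) * r)).
Proof.
move=> hK hL KL LK _ [_ /KL[y Ly [z zr <-]] <-].
exists (y - steiner_point L); first by exists y.
exists (z + (steiner_point L - steiner_point K)); last first.
  by rewrite addrACA addKr.
rewrite /eball/= (le_trans (enormD _ _))// mulrDl mul1r lerD//.
exact: steiner_point_lipschitz.
Qed.

Lemma J_continuous K (e : R) : convex_body K -> 0 < e ->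
  exists2 d : R, 0 < d & forall L, convex_body L ->
    hausdorff_dist K L < d -> hausdorff_dist (J K) (J L) < e.
Proof.
move=> hK e0; have c0 : 0 < 1 + n%:R * n%:R :> R by rewrite ltr_wpDr// mulr_ge0.
exists (e / (1 + n%:R * n%:R)); first exact: divr_gt0.
move=> L hL /hausdorff_dist_lt[]// r [r0 rd KL LK].
apply: (@le_lt_trans _ _ ((1 + n%:R * n%:R) * r)); last first.
  by rewrite mulrC -ltr_pdivlMr.
apply: hausdorff_dist_le; [|exact: J_sub_eball..].
by rewrite mulr_ge0// ltW.
Qed.

Lemma J_minkowski_endomorphism : minkowski_endomorphism (@J R n).
Proof.
split.
- by move=> K; exact: convex_body_translate.
- by move=> K hK e; exact: J_continuous.
- exact: J_minkowski_sum.
- by move=> K v; exact: J_translate.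
- by move=> K U hK [UU _]; exact: J_orthogonal.
Qed.

Lemma J_weakly_monotone : weakly_monotone (@J R n).
Proof. by move=> K L _ _; rewrite /J => -> ->; exact: image_subset. Qed.

End endomorphism.

(** An intersection of half-spaces, each a sublevel set of the support function of a point, whose
    continuity is known. Closedness serves to make the polar body measurable. *)
Lemma closed_polar (R : realType) n (L : set 'rV[R]_n) : closed (polar L).
Proof.
rewrite (_ : polar L = \bigcap_(y in L)
    (support_function [set y] @^-1` [set t | t <= 1])); last first.
  by apply/seteqP; split=> x /= h y Ly; have := h y Ly;
    rewrite /= support_function_set1.
apply: closed_bigI => y Ly; apply: closed_comp; last exact: closed_le.
by move=> x _; apply: continuous_support_function; [exists y|exact: compact_set1].
Qed.

(** * Flat pyramids and the unbounded volume product *)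

Section pyramid.
Context (R : realType) (m : nat).
Hypothesis m0 : (0 < m)%N.
Implicit Types (u v x : 'rV[R]_m.+1).
Local Notation n := m.+1.
Local Notation S := (@unit_sphere R n).
Local Notation sigma := (@sphere_measure R n).
Local Notation b := (fine (lebesgue_rV R n (eball 1))).
Local Notation up := (lift (ord0 : 'I_n)).

(** Coordinate 0 is the height; the base is the cube [-1,1]^m at height 0 and the apex is the point
    at height [e] on the axis. *)
Definition pyramid (e : R) : set 'rV[R]_n :=
  [set x | 0 <= x 0 ord0 /\ forall i, `|x 0 (up i)| + x 0 ord0 / e <= 1].

(** A tube around the axis. Its trace on the sphere consists of the directions that may see the
    apex. *)
Definition slab (e : R) : set 'rV[R]_n := [set x | forall i, `|x 0 (up i)| <= e].

Let closed_le_continuous (f : 'rV[R]_n -> R) c :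
  continuous f -> closed [set x | f x <= c].
Proof.
move=> cf; apply: (@closed_comp _ _ f [set t | t <= c]); last exact: closed_le.
by move=> x _; exact: cf.
Qed.

Let continuous_normr_coord i : continuous (fun x : 'rV[R]_n => `|x 0 i|).
Proof.
move=> x; apply: (@continuous_comp _ _ _ (fun x : 'rV[R]_n => x 0 i) Num.norm).
  exact: coord_continuous.
exact: norm_continuous.
Qed.

Lemma closed_slab e : closed (slab e).
Proof.
rewrite (_ : slab e = \bigcap_(i in [set: 'I_m]) [set x | `|x 0 (up i)| <= e]).
  by apply: closed_bigI => i _; exact/closed_le_continuous/continuous_normr_coord.
by apply/seteqP; split=> x h i; [move=> _; exact: h|exact: (h i I)].
Qed.

Section fixed_height.
Variable e : R.
Hypotheses (e0 : 0 < e) (e1 : e <= 1).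
Local Notation K := (pyramid e).

Lemma closed_pyramid : closed K.
Proof.
rewrite (_ : K = [set x | - x 0 ord0 <= 0] `&`
  \bigcap_(i in [set: 'I_m]) [set x | `|x 0 (up i)| + x 0 ord0 / e <= 1]).
  apply: closedI.
    apply: closed_le_continuous => x.
    apply: (@continuousN R R^o 'rV[R]_n (fun x => x 0 ord0)).
    exact: coord_continuous.
  apply: closed_bigI => i _; apply: closed_le_continuous => x.
  apply: (@continuousD R R^o 'rV[R]_n (fun x => `|x 0 (up i)|) (fun x => x 0 ord0 / e)).
    exact: continuous_normr_coord.
  apply: (@continuousM R 'rV[R]_n (fun x => x 0 ord0) (cst e^-1)).
    exact: coord_continuous.
  exact: cst_continuous.
apply/seteqP; split=> x.
  by move=> [x0 xi]; split=> [/=|i _]; [rewrite oppr_le0|exact: xi].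
by move=> [/= x0 xi]; split=> [|i]; [rewrite -oppr_le0|exact: (xi i I)].
Qed.

Lemma pyramid_coord_le x i : K x -> `|x 0 i| <= 1.
Proof.
move=> [x0 xi].
have xe : 0 <= x 0 ord0 / e by rewrite divr_ge0// ltW.
have [j ->|->] := unliftP ord0 i.
  by have := xi j; lra.
(* The height is bounded only through the constraint of some horizontal coordinate, which exists as
   m > 0. *)
have := xi (Ordinal m0); have := normr_ge0 (x 0 (up (Ordinal m0))).
move=> h1 h2; rewrite ger0_norm//.
by have : x 0 ord0 / e <= 1 by [lra]; rewrite ler_pdivrMr// mul1r => /le_trans; apply.
Qed.

Lemma pyramid_enorm_le x : K x -> enorm x <= n%:R.
Proof.
move=> Kx; rewrite (le_trans (enorm_le_sum x))//.
apply: (@le_trans _ _ (\sum_(i < n) 1)); last by rewrite sumr_const card_ord.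
by apply: ler_sum => i _; exact: pyramid_coord_le.
Qed.

Lemma pyramid0 : K 0.
Proof. by split=> [|i]; rewrite !mxE// normr0 mul0r addr0. Qed.

Lemma compact_pyramid : compact K.
Proof.
apply: bounded_closed_compact; last exact: closed_pyramid.
exists 1; split=> [|c c1 x Kx]; first exact: num_real.
rewrite /= [leLHS]/Num.norm /= mx_normrE; apply/bigmax_leP; split=> /=.
  by rewrite ltW// (lt_trans ltr01).
by move=> [i j] _ /=; rewrite (ord1 i) (le_trans (pyramid_coord_le _ Kx))// ltW.
Qed.

Lemma convex_body_pyramid : convex_body K.
Proof.
split; [by exists 0; exact: pyramid0|exact: compact_pyramid|].
apply/convex_setP => x y t [x0 xi] [y0 yi] /andP[t0 t1].
have t1' : 0 <= 1 - t by lra.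
split=> [|i]; first by rewrite !mxE addr_ge0// mulr_ge0.
rewrite !mxE; apply: (@le_trans _ _ (t * (`|x 0 (up i)| + x 0 ord0 / e) +
    (1 - t) * (`|y 0 (up i)| + y 0 ord0 / e))).
  rewrite (le_trans (lerD (ler_normD _ _) (lexx _)))// !normrM !(ger0_norm t0) (ger0_norm t1').
  by rewrite le_eqVlt; apply/orP; left; apply/eqP; ring.
have := ler_wpM2l t0 (xi i); have := ler_wpM2l t1' (yi i); lra.
Qed.

Lemma interior_pyramid : interior K !=set0.
Proof.
exists (\row_i (if i == ord0 then e / 4 else 0)).
apply/nbhs_ballP; exists (e / 4) => /=; first by rewrite divr_gt0.
move=> x [_ /(_ 0) bx]; rewrite /ball /= in bx.
have := bx ord0; rewrite mxE /= ltr_norml => /andP[x1 x2].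
have x0 : 0 <= x 0 ord0 by lra.
split=> // i.
have := bx (up i); rewrite mxE /= sub0r normrN => xi.
have : x 0 ord0 / e <= 1 / 2 by rewrite ler_pdivrMr//; lra.
by move=> h; rewrite (le_trans (lerD (ltW xi) h))//; move: e1; lra.
Qed.

(* Only the directions close to the axis see the apex: in any other direction
   u the base already contains a maximiser of u. *)
Lemma support_function_pyramid_le u : S u -> 0 <= u 0 ord0 ->
  support_function K u <= support_function K (u *m reflection R ord0) + e * \1_(slab e) u.
Proof.
move=> Su u0; apply: support_function_le; first by exists 0; exact: pyramid0.
move=> x Kx; have [x0 xi] := Kx.
(* Projection to the base hyperplane. The reflection fixes this hyperplane, so u and its mirror
   image take the same value at [base z]. *)
pose base (z : 'rV[R]_n) : 'rV[R]_n := \row_i (if i == ord0 then 0 else z 0 i).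
have dotS v w : dot v w = v 0 ord0 * w 0 ord0 + \sum_i v 0 (up i) * w 0 (up i).
  by rewrite /dot big_ord_recl.
have base0 z : base z 0 ord0 = 0 by rewrite mxE.
have baseS z i : base z 0 (up i) = z 0 (up i) by rewrite mxE.
have base_pyramid (z : 'rV[R]_n) : (forall i, `|z 0 (up i)| <= 1) -> K (base z).
  by move=> z1; split=> [|i]; rewrite base0// baseS mul0r addr0.
have le_base z : K (base z) ->
    \sum_i u 0 (up i) * z 0 (up i) <= support_function K (u *m reflection R ord0).
  move=> Kz; apply: le_trans (dot_le_support_function _ compact_pyramid Kz).
  rewrite dotS base0 mulr0 add0r le_eqVlt; apply/orP; left; apply/eqP.
  by apply: eq_bigr => i _; rewrite mul_reflection baseS mul1r.
have xe : x 0 ord0 <= e.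
  have := xi (Ordinal m0); have := normr_ge0 (x 0 (up (Ordinal m0))) => h1 h2.
  by have : x 0 ord0 / e <= 1 by [lra]; rewrite ler_pdivrMr// mul1r.
have xe0 : 0 <= x 0 ord0 / e by rewrite divr_ge0// ltW.
have u1 : u 0 ord0 <= 1.
  by rewrite -Su (le_trans (ler_norm _))// normr_coord_le_enorm.
(* Near the axis the point is simply projected to the base, at a loss of x_0 u_0 <= e. *)
rewrite dotS addrC indicE; have [us|/negP us] := boolP (u \in slab e).
  rewrite mulr1 lerD//; last by rewrite -[e]mul1r ler_pM.
  by apply/le_base/base_pyramid => i; have := xi i; lra.
rewrite mulr0 addr0.
have [j uj] : exists j, e < `|u 0 (up j)|.
  apply: contrapT => h; apply: us; rewrite inE => i; rewrite leNgt; apply/negP => ui.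
  by apply: h; exists i.
(* Away from the axis the point is also pushed outwards by x_0 / e in a direction j with |u_j| > e.
   The pyramid constraint leaves exactly this room inside the cube, and the gain x_0 |u_j| / e >=
   x_0 outweighs the loss x_0 u_0. *)
pose z : 'rV[R]_n := x + (x 0 ord0 / e * Num.sg (u 0 (up j))) *: delta_mx 0 (up j).
have Kz : K (base z).
  apply: base_pyramid => i; rewrite !mxE eqxx /=; have [->|ij] := eqVneq i j.
    rewrite eqxx mulr1 (le_trans (ler_normD _ _))// normrM (ger0_norm xe0).
    apply: le_trans (xi j); rewrite lerD2l -[leRHS]mulr1 ler_wpM2l//.
    by rewrite normr_sg; case: (_ != 0).
  rewrite (inj_eq lift_inj) (negbTE ij) mulr0 addr0; have := xi i; lra.
apply: le_trans (le_base _ Kz).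
have -> : \sum_i u 0 (up i) * z 0 (up i) =
    \sum_i u 0 (up i) * x 0 (up i) + x 0 ord0 / e * `|u 0 (up j)|.
  under eq_bigr do rewrite [z 0 _]mxE mulrDr.
  rewrite big_split /=; congr (_ + _); rewrite (bigD1 j)//= big1 => [|i ij].
    by rewrite !mxE !eqxx mulr1 addr0 normrEsg; ring.
  by rewrite !mxE (inj_eq lift_inj) (negbTE ij) andbF !mulr0.
rewrite lerD2l; apply: (@le_trans _ _ (x 0 ord0 / e * e)).
  by rewrite divfK ?gt_eqF// -[leRHS]mul1r ler_wpM2r.
by rewrite ler_wpM2l// ltW.
Qed.

(** The cone over these directions lies in the box [-1,1] x [-e,e]^m of volume 2 (2e)^m, and e^m <=
    e since e <= 1 and m >= 1. *)
Lemma sphere_measure_slab :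
  fine (sigma (slab e `&` S)) <= n%:R * (2 ^+ n * e).
Proof.
have bx : lebesgue_rV R n [set x | forall i, (if i == ord0 then -1 else - e) <= x 0 i
    <= (if i == ord0 then 1 else e)] = (2 * (2 * e) ^+ m)%:E.
  rewrite lebesgue_rV_box; last by move=> i; case: ifP => _; move: e0; lra.
  rewrite big_ord_recl /= (eq_bigr (fun=> 2 * e)) => [|i _]; last by rewrite /=; ring.
  by rewrite prodr_const card_ord; congr (_ * _)%:E; ring.
have le : (lebesgue_rV R n
    [set x | (0 < enorm x <= 1)%R /\ (slab e `&` S) ((enorm x)^-1 *: x)%R] <=
    (2 * (2 * e) ^+ m)%:E)%E.
  rewrite -bx; apply: le_measure; rewrite ?inE.
  - apply: measurable_sphere_preimage; apply: measurableI.
      by apply: closed_measurable_rV; exact: closed_slab.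
    exact: measurable_unit_sphere.
  - exact: measurable_box.
  move=> x /= [/andP[x0 x1] [xs _]] i.
  have [j ->|->] := unliftP ord0 i; last first.
    by rewrite -ler_norml (le_trans (normr_coord_le_enorm _ _)).
  rewrite /= -ler_norml; have := xs j.
  rewrite mxE normrM gtr0_norm ?invr_gt0// ler_pdivrMl// => /le_trans; apply.
  by rewrite -[leRHS]mul1r ler_wpM2r// ltW.
rewrite -lee_fin fineK; last first.
  rewrite ge0_fin_numE//; apply: le_lt_trans (sphere_measure_fin R n).
  apply: le_measure; rewrite ?inE.
  - apply: measurableI; last exact: measurable_unit_sphere.
    by apply: closed_measurable_rV; exact: closed_slab.
  - exact: measurable_unit_sphere.
  - exact: subIsetr.
rewrite EFinM; apply: lee_wpmul2l; first by rewrite lee_fin.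
apply: (le_trans le); rewrite lee_fin exprS -mulrA ler_wpM2l//.
rewrite exprMn ler_wpM2l ?exprn_ge0// -(prednK m0) exprS -[leRHS]mulr1.
by rewrite (ler_wpM2l (ltW e0))// exprn_ile1// ltW.
Qed.

(** Averaging the integral I of h(u) u_0 with its image under the reflection gives 2 I as the
    integral of (h(u) - h(u rho)) u_0. This integrand is at most [e] times the indicator of the
    slab, whose trace on the sphere has measure O(e). *)
Lemma steiner_point_pyramid_le :
  steiner_point K 0 ord0 <= n%:R * 2 ^+ m / b * e ^+ 2.
Proof.
have b0 := ball_volume_gt0 R n.
pose h := support_function K; pose rho := reflection R (ord0 : 'I_n).
have rhorho : rho *m rho^T = 1%:M by exact: reflection_orthogonal.
have rhoK u : u *m rho *m rho = u.
  by rewrite -[X in _ *m X](tr_diag_mx) -mulmxA rhorho mulmx1.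
have rho0 u : (u *m rho) 0 ord0 = - u 0 ord0.
  by rewrite mul_reflection eqxx expr1 mulN1r.
have hh : sphere_bounded h.
  by apply: sphere_bounded_support_function; [exists 0; exact: pyramid0|exact: compact_pyramid].
have hhr := sphere_bounded_orthogonal rhorho hh.
have hc := sphere_bounded_coord R (ord0 : 'I_n).
pose I := \int[sigma]_(u in S) (h u * u 0 ord0).
have I2 : \int[sigma]_(u in S) ((h u - h (u *m rho)) * u 0 ord0) = I + I.
  rewrite {2}/I -(sphere_integral_invariant rhorho (sphere_boundedM hh hc)).
  rewrite -sphere_integralD; [| exact: sphere_boundedM |]; last first.
    by apply: sphere_boundedM => //; exact: sphere_bounded_orthogonal rhorho hc.
  by apply: eq_Rintegral => u _; rewrite rho0; ring.
have mslab : measurable (slab e).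
  by apply: closed_measurable_rV; exact: closed_slab.
have hs : sphere_bounded (\1_(slab e) : 'rV[R]_n -> R).
  split; first exact: measurable_indic.
  by exists 1 => u _; rewrite indicE; case: (_ \in _); rewrite ?normr1 ?normr0.
have slabN u : \1_(slab e) (u *m rho) = \1_(slab e) u :> R.
  rewrite !indicE; congr (_%:R); congr (nat_of_bool _).
  by apply/idP/idP; rewrite !inE => us i; have := us i; rewrite mul_reflection /= mul1r.
(* Both sides are invariant under the reflection, so the case u_0 >= 0 suffices. *)
have pointwise u : S u -> (h u - h (u *m rho)) * u 0 ord0 <= e * \1_(slab e) u.
  have key v : S v -> 0 <= v 0 ord0 ->
      (h v - h (v *m rho)) * v 0 ord0 <= e * \1_(slab e) v.
    move=> Sv v0; apply: (@le_trans _ _ (e * \1_(slab e) v * v 0 ord0)).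
      by rewrite ler_wpM2r// lerBlDl support_function_pyramid_le.
    rewrite -[leRHS]mulr1 ler_wpM2l ?(mulr_ge0 (ltW e0))//.
    by rewrite -Sv (le_trans (ler_norm _))// normr_coord_le_enorm.
  move=> Su; have [u0|u0] := leP 0 (u 0 ord0); first exact: key.
  rewrite -slabN; apply: le_trans (key (u *m rho) _ _).
  - by rewrite rhoK rho0 mulrN -mulNr opprB.
  - by rewrite /unit_sphere/= enorm_orthogonal.
  - by rewrite rho0 oppr_ge0 ltW.
have I2le : I + I <= e * (n%:R * (2 ^+ n * e)).
  rewrite -I2; apply: (@le_trans _ _ (\int[sigma]_(u in S) (e * \1_(slab e) u))).
    apply: le_sphere_integral => //; last exact: sphere_boundedZ.
    by apply: sphere_boundedM => //; apply: sphere_boundedD => //; exact: sphere_boundedN.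
  rewrite sphere_integralZ// (ler_wpM2l (ltW e0))//.
  apply: le_trans sphere_measure_slab.
  by rewrite /Rintegral integral_indic//; exact: measurable_unit_sphere.
rewrite steiner_pointE -/h -/I ler_pdivrMl//.
have -> : b * (n%:R * 2 ^+ m / b * e ^+ 2) = n%:R * 2 ^+ m * e ^+ 2.
  by field; rewrite gt_eqF.
move: I2le; rewrite exprS; set p := 2 ^+ m; set q := n%:R; lra.
Qed.

End fixed_height.

Lemma volume_product_J_unbounded (M : R) :
  exists K : set 'rV[R]_n, [/\ convex_body K, interior K !=set0
    & (M%:E < volume_product (@J R n) K)%E].
Proof.
have b0 := ball_volume_gt0 R n.
pose c : R := n%:R * 2 ^+ m / b.
have c0 : 0 < c by rewrite divr_gt0// mulr_gt0// exprn_gt0.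
(* Bounds every |x_i - s_i|, as |x_i| <= 1 and |s_i| <= n^2, independently of the height [e]. *)
pose N : R := 1 + n%:R * n%:R.
have N0 : 0 < N by rewrite ltr_wpDr// mulr_ge0.
have m0' : 0 < m%:R :> R by rewrite ltr0n.
(* Chosen so that the m horizontal terms, each at most a N, sum to 1/2. *)
pose a : R := (2 * m%:R * N)^-1.
have a0 : 0 < a by rewrite invr_gt0 !mulr_gt0.
(* With this constant the two box volumes below multiply to exactly A / e. *)
pose A : R := (2 * a) ^+ m / (4 * c).
have A0 : 0 < A by apply: divr_gt0; [apply: exprn_gt0|]; exact: mulr_gt0.
have M0 : 0 < `|M| + 1 by rewrite ltr_wpDl.
(* Makes A / e at least |M| + 1 while keeping e <= 1. *)
pose e := Num.min 1 (A / (`|M| + 1)).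
have e0 : 0 < e by rewrite lt_min ltr01 divr_gt0.
have e1 : e <= 1 by rewrite ge_min lexx.
have Me : M < A / e.
  rewrite ltr_pdivlMr//; apply: (@lt_le_trans _ _ ((`|M| + 1) * e)).
    by rewrite ltr_pM2r// ltr_pwDr// ler_norm.
  by rewrite mulrC -ler_pdivlMr// ge_min lexx orbT.
pose K := pyramid e; pose s := steiner_point K.
have cK : compact K by exact: compact_pyramid.
exists K; split; [exact: convex_body_pyramid|exact: interior_pyramid|].
have s0 : s 0 ord0 <= c * e ^+ 2 by exact: steiner_point_pyramid_le.
have sN i : `|s 0 i| <= n%:R * n%:R.
  apply: normr_steiner_point_le => //; first by exists 0; exact: pyramid0.
  move=> u Su; apply: le_trans (normr_support_function_le u _ cK _) _.
  - by exists 0; exact: pyramid0.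
  - by move=> x; exact: pyramid_enorm_le.
  - by rewrite Su mul1r.
have volK : ((e / 2)%:E <= lebesgue_rV R n K)%E.
  have bx : lebesgue_rV R n [set x | forall i, (if i == ord0 then 0 else - 2^-1) <= x 0 i
      <= (if i == ord0 then e / 2 else 2^-1)] = (e / 2)%:E.
    rewrite lebesgue_rV_box; last by move=> i; case: ifP => _; lra.
    rewrite big_ord_recl /= big1 => [|i _]; first by rewrite subr0 mulr1.
    by rewrite /=; lra.
  rewrite -bx; apply: le_measure; rewrite ?inE; first exact: measurable_box.
    by apply: closed_measurable_rV; exact: closed_pyramid.
  move=> x xb; have /andP[/= x0 x1] := xb ord0; split=> // i.
  have := xb (up i); rewrite /= -ler_norml => xi.
  have h : x 0 ord0 / e <= 2^-1 by rewrite ler_pdivrMr// mulrC.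
  by rewrite (le_trans (lerD xi h))//; lra.
(* Chosen so that [d] times the bound c e^2 on the height of the Steiner point is 1/2. *)
pose d : R := (2 * c * e ^+ 2)^-1.
have d0 : 0 < d by rewrite invr_gt0; apply: mulr_gt0; [exact: mulr_gt0|exact: exprn_gt0].
have volP : ((d * (2 * a) ^+ m)%:E <= lebesgue_rV R n (polar (J K)))%E.
  (* For z_0 <= 0 and x_0 >= 0 the vertical term z_0 (x_0 - s_0) is at most -z_0 s_0, so the apex
     does not restrict [d]. *)
  have bx : lebesgue_rV R n [set x | forall i, (if i == ord0 then - d else - a) <= x 0 i
      <= (if i == ord0 then 0 else a)] = (d * (2 * a) ^+ m)%:E.
    rewrite lebesgue_rV_box; last by move=> i; case: ifP => _; lra.
    rewrite big_ord_recl /= (eq_bigr (fun=> 2 * a)) => [|i _]; last by rewrite /=; ring.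
    by rewrite prodr_const card_ord; congr (_ * _)%:E; ring.
  rewrite -bx; apply: le_measure; rewrite ?inE; first exact: measurable_box.
    by apply: closed_measurable_rV; exact: closed_polar.
  move=> z zb _ [x Kx <-]; have [x0 _] := Kx; rewrite -/s.
  have /andP[/= z1 z0] := zb ord0.
  rewrite /dot big_ord_recl.
  have sub i : (x - s) 0 i = x 0 i - s 0 i by rewrite mxE [X in _ + X]mxE.
  have h0 : z 0 ord0 * (x - s) 0 ord0 <= 2^-1.
    rewrite sub mulrBr -mulNr; apply: (@le_trans _ _ (- z 0 ord0 * s 0 ord0)).
      by rewrite mulNr gerDr mulr_le0_ge0.
    apply: (@le_trans _ _ (- z 0 ord0 * (c * e ^+ 2))).
      by rewrite ler_wpM2l// oppr_ge0.
    apply: (@le_trans _ _ (d * (c * e ^+ 2))).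
      by rewrite ler_wpM2r ?(mulr_ge0 (ltW c0)) ?sqr_ge0// lerNl.
    rewrite le_eqVlt; apply/orP; left; apply/eqP; rewrite /d; field.
    by rewrite !gt_eqF.
  have h1 : \sum_i z 0 (up i) * (x - s) 0 (up i) <= 2^-1.
    apply: (@le_trans _ _ (\sum_(i < m) (a * N))).
      apply: ler_sum => i _; rewrite (le_trans (ler_norm _))// normrM ler_pM//.
        by have := zb (up i); rewrite /= -ler_norml.
      rewrite sub (le_trans (ler_normB _ _))// lerD ?sN//.
      exact: pyramid_coord_le Kx.
    rewrite sumr_const card_ord -[leLHS]mulr_natr.
    rewrite le_eqVlt; apply/orP; left; apply/eqP; rewrite /a; field.
    by rewrite !gt_eqF.
  by have := lerD h0 h1; lra.
rewrite /volume_product; apply: (@lt_le_trans _ _ ((e / 2)%:E * (d * (2 * a) ^+ m)%:E)%E).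
  rewrite -EFinM lte_fin.
  have -> // : e / 2 * (d * (2 * a) ^+ m) = A / e.
  by rewrite /A /d; move: (_ ^+ m) => p; field; rewrite !gt_eqF.
by apply: lee_pmul => //; rewrite lee_fin ?mulr_ge0 ?exprn_ge0 ?mulr_ge0 ?ltW// divr_ge0// ltW.
Qed.

End pyramid.

Theorem theorem4p1 (R : realType) (n : nat) (n_ge2 : (2 <= n)%N) :
  [/\ minkowski_endomorphism (@J R n),
      weakly_monotone (@J R n)
    & forall M : R, exists K : set 'rV[R]_n,
        [/\ convex_body K, interior K !=set0
          & (M%:E < volume_product (@J R n) K)%E]].
Proof.
split; [|exact: J_weakly_monotone|].
  by apply: J_minkowski_endomorphism; exact: ltnW.
by case: n n_ge2 => [//|m] m1; exact: volume_product_J_unbounded.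
Qed.
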